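(* Let $m$ be a positive integer and $\mathbf{x}=(x_1,\dots,x_k)$. Then $$\sum_{\substack{\lambda=(\alpha+2m,m-\delta|\alpha,0)\\ \delta\in\{0,1\}}}(-1)^{\frac{|\lambda|+\operatorname{rk}\lambda-\delta+m}{2}+m\operatorname{rk}\lambda} s_\lambda(\mathbf{x})=\prod^k_{i=1}(1-x_i)\prod_{1 \leq i< j \leq k}(1-x_ix_j)\,\det\left(f_{s-t+1}(\mathbf{x})+f_{s+t}(\mathbf{x})\right)_{1\leq s,t\leq m},$$ $$\sum_{\substack{\lambda=(\alpha+2m+1,m+1|\alpha,0)\ \text{and}\\ \lambda=(\alpha+2m+1,m-1|\alpha,0)}}(-1)^{\frac{|\lambda|+m}{2}+m\operatorname{rk}\lambda} s_\lambda(\mathbf{x})=\prod_{1 \leq i\leq j \leq k}(1-x_ix_j)\,\det\left(f_{s-t+1}(\mathbf{x})-f_{s+t+1}(\mathbf{x})\right)_{1\leq s,t\leq m},$$ $$\sum_{\lambda=(\alpha+2m-1,m-1|\alpha,0)}(-1)^{\frac{|\lambda|+m}{2}+m\operatorname{rk}\lambda} s_\lambda(\mathbf{x})=\frac{1}{2}\prod_{1 \leq i< j \leq k}(1-x_ix_j)\,\det\left(f_{s-t+1}(\mathbf{x})+f_{s+t-1}(\mathbf{x})\right)_{1\leq s,t\leq m},$$ where each sum runs over all partitions $\lambda$ of the indicated form(s).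
   Context: Frobenius notation: for a partition $\lambda$ with conjugate $\lambda'$, the rank $r=\operatorname{rk}\lambda$ is the largest integer with $\lambda_r\ge r$, and $\lambda=(\alpha_1,\dots,\alpha_r|\beta_1,\dots,\beta_r)$ with $\alpha_i=\lambda_i-i$, $\beta_i=\lambda'_i-i$, both strictly decreasing sequences of nonnegative integers. For integers $c,d$, the shorthand $(\alpha+c,d|\alpha,0)$ denotes the partition $(\alpha_1+c,\dots,\alpha_{r-1}+c,d\,|\,\alpha_1,\dots,\alpha_{r-1},0)$ of rank $r\ge 1$, where $\alpha_1>\dots>\alpha_{r-1}>0$ (the sequence $\alpha$ may be empty, giving $(d|0)$). $|\lambda|$ is the sum of the parts. $s_\lambda(\mathbf{x})$ is the Schur polynomial in $x_1,\dots,x_k$, which is $0$ when $\lambda$ has more than $k$ parts (so all sums are finite). For $i\ge 0$, $$f_i(\mathbf{x})=f_{-i}(\mathbf{x})=\sum^{k-i}_{j=0}e_j(\mathbf{x})e_{i+j}(\mathbf{x}),$$ with $e_j$ the elementary symmetric polynomials; the sum is empty (zero) if $i>k$. *)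

(* Defs.v *)
From HB Require Import structures.
From mathcomp Require Import all_boot all_order all_algebra.
From mathcomp Require Import boolp classical_sets fsbigop.
From mathcomp Require Import mpoly.

Set Implicit Arguments.
Unset Strict Implicit.
Unset Printing Implicit Defensive.

Import GRing.Theory.
Local Open Scope ring_scope.

(* A partition is the weakly decreasing list of its positive parts. *)
Definition is_partition (l : seq nat) : bool :=
  sorted geq l && all (ltn 0%N) l.

(* Parts and conjugate parts are indexed from 1: part l i is lambda_i, and
   conj_part l j is lambda'_j, the number of parts that are at least j. *)
Definition part (l : seq nat) (i : nat) : nat := nth 0%N l i.-1.

Definition conj_part (l : seq nat) (j : nat) : nat := count (leq j) l.

Definition rk (l : seq nat) : nat :=
  \max_(1 <= r < (size l).+1 | (r <= part l r)%N) r.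

(* The truncated subtractions are exact: lambda_i >= i and lambda'_i >= i
   for 1 <= i <= rk lambda. *)
Definition frob_arm (l : seq nat) : seq nat :=
  [seq (part l i - i)%N | i <- iota 1 (rk l)].

Definition frob_leg (l : seq nat) : seq nat :=
  [seq (conj_part l i - i)%N | i <- iota 1 (rk l)].

(* The partitions (alpha + c, d | alpha, 0), alpha ranging over the strictly
   decreasing, possibly empty, sequences of positive integers. *)
Definition frob_shape (c d : nat) : set (seq nat) :=
  [set l | is_partition l /\
     exists alpha : seq nat,
       [/\ sorted gtn alpha, all (ltn 0%N) alpha,
           frob_arm l = rcons [seq (a + c)%N | a <- alpha] d
         & frob_leg l = rcons alpha 0%N]]%classic.

(* The alternant det (x_i ^ (lambda_j + k - j)), with 1 <= i, j <= k. *)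
Definition alternant (k : nat) (l : seq nat) : {mpoly rat[k]} :=
  \det (\matrix_(i < k, j < k) ('X_i ^+ (part l j.+1 + (k - j.+1)))).

(* Schur polynomials as quotients of alternants; the quotient is taken in the
   field of fractions of the polynomial ring. *)
Definition schur (k : nat) (l : seq nat) : {fraction {mpoly rat[k]}} :=
  if (size l <= k)%N
  then tofrac (alternant k l) / tofrac (alternant k [::])
  else 0.

(* The summation range is empty when `|i| > k. *)
Definition f_poly (k : nat) (i : int) : {mpoly rat[k]} :=
  \sum_(j < k.+1 - `|i|) mesym k rat j * mesym k rat (`|i| + j)%N.

(* Main.v *)
Require Import Defs.
From mathcomp Require Import all_boot all_order all_algebra.
From mathcomp Require Import boolp classical_sets fsbigop.
From mathcomp Require Import mpoly.
From mathcomp Require Import zify ring.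

(* In terms of the exponents lambda_j + k - j, a partition (alpha + c, d | alpha, 0)
   is obtained from the staircase by replacing k-1 by k+d and k-1-alpha_i by
   k+c+alpha_i.  Hence the left-hand sides, multiplied by the Vandermonde
   determinant, are expansions by multilinearity of a single k x k determinant
   with rows (x_i^(k-1-j) +- x_i^(k+c+j)), 0 < j < k, and a special first row.
   After extracting a power of x_i its rows are the members of index 0, m+1, ...,
   m+k-1 of the sequence x^-u +- x^(u+kap), 0 <= u < k+m, with kap = 1, 2, 0.
   The f_i are, up to sign, the coefficients of the Laurent polynomial
   prod_j (1 - x_j t)(1 - x_j / t), which vanishes at t = x_i; its multiples by
   t^-s +- t^(s+kap), s < m, therefore span the common kernel of the evaluations
   at x_1, ..., x_k.  The k x k minors of the evaluation matrix are proportional to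
   the complementary m x m minors of a kernel basis, and the factor is found from
   the first k rows, whose minor is a Vandermonde determinant in x + 1/x. *)

Set Implicit Arguments.
Unset Strict Implicit.
Unset Printing Implicit Defensive.

Import GRing.Theory.
Local Open Scope ring_scope.

(** * Determinants of matrices indexed by natural numbers *)

Section NatDet.
Variable R : comNzRingType.
Implicit Types (n p q b : nat) (g h : nat -> nat -> R).

(** Entries are given on all pairs of naturals, so that shifting, splitting and permuting rows is
    arithmetic on indices, without casts between ordinal types. *)
Definition ndet n g : R := \det (\matrix_(i < n, j < n) g i j).

Lemma eq_ndet n g h :
  (forall i j, (i < n)%N -> (j < n)%N -> g i j = h i j) -> ndet n g = ndet n h.
Proof. by move=> gh; congr (\det _); apply/matrixP=> i j; rewrite !mxE gh. Qed.

Lemma ndet_tr n g : ndet n (fun i j => g j i) = ndet n g.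
Proof.
by rewrite /ndet -det_tr; congr (\det _); apply/matrixP=> i j; rewrite !mxE.
Qed.

Lemma ndet_lblock p q g :
  (forall i j, (i < p)%N -> (j < q)%N -> g i (p + j)%N = 0) ->
  ndet (p + q) g = ndet p g * ndet q (fun i j => g (p + i)%N (p + j)%N).
Proof.
move=> g0; rewrite /ndet -[X in \det X = _]submxK.
rewrite (_ : ursubmx _ = 0); last by apply/matrixP=> i j; rewrite !mxE /= g0.
rewrite det_lblock; congr (_ * _); congr (\det _); apply/matrixP=> i j;
  by rewrite !mxE.
Qed.

Lemma ndet_ublock p q g :
  (forall i j, (i < q)%N -> (j < p)%N -> g (p + i)%N j = 0) ->
  ndet (p + q) g = ndet p g * ndet q (fun i j => g (p + i)%N (p + j)%N).
Proof.
move=> g0; rewrite -ndet_tr ndet_lblock; last by move=> i j ip jq; apply: g0.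
by rewrite ndet_tr (ndet_tr _ (fun i j => g (p + i)%N (p + j)%N)).
Qed.

Lemma ndet_delta n : ndet n (fun i j => (i == j)%:R) = 1.
Proof. by rewrite -[RHS](det1 R n); congr (\det _); apply/matrixP=> i j; rewrite !mxE. Qed.

Lemma ndet_mul n g h :
  ndet n g * ndet n h = ndet n (fun i j => \sum_(u < n) g i u * h u j).
Proof.
rewrite /ndet -det_mulmx; congr (\det _); apply/matrixP=> i j; rewrite !mxE.
by apply: eq_bigr => u _; rewrite !mxE.
Qed.

Lemma ndet_scale n (c d : nat -> R) g :
  ndet n (fun i j => c i * d j * g i j)
  = (\prod_(i < n) c i) * (\prod_(i < n) d i) * ndet n g.
Proof.
have -> : ndet n (fun i j => c i * d j * g i j) =
  \det (diag_mx (\row_(i < n) c i) *m (\matrix_(i < n, j < n) g i j)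
          *m diag_mx (\row_(i < n) d i)).
  congr (\det _); apply/matrixP=> i j.
  by rewrite mul_mx_diag mxE mul_diag_mx !mxE mulrAC.
rewrite !det_mulmx !det_diag mulrAC; congr (_ * _ * _);
  by apply: eq_bigr => i _; rewrite mxE.
Qed.

Lemma ndet_row_linear n r g (a b : nat -> R) (c : R) : (r < n)%N ->
  ndet n (fun i j => if i == r then a j + c * b j else g i j)
  = ndet n (fun i j => if i == r then a j else g i j)
    + c * ndet n (fun i j => if i == r then b j else g i j).
Proof.
move=> rn; rewrite /ndet -[X in _ = X + _]mul1r.
apply: (determinant_multilinear (i0 := Ordinal rn)).
- by apply/rowP=> j; rewrite !mxE /= eqxx mul1r.
- by apply/matrixP=> i j; rewrite !mxE /= /bump; case: eqP => //; lia.
- by apply/matrixP=> i j; rewrite !mxE /= /bump; case: eqP => //; lia.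
Qed.

(* Row i of the matrix obtained by moving row b to the top is row to_front b i. *)
Definition to_front b i : nat :=
  if i == 0%N then b else if (i <= b)%N then i.-1 else i.

(** Expanding the left determinant along row 0 and the right one along row b gives the same entries
    and the same minors; only the cofactor signs differ, by (-1)^b. *)
Lemma ndet_to_front n b g : (b < n)%N ->
  ndet n (fun i j => g (to_front b i) j) = (-1) ^+ b * ndet n g.
Proof.
case: n => // n bn; rewrite /ndet (expand_det_row _ ord0).
rewrite (expand_det_row _ (Ordinal bn)) mulr_sumr; apply: eq_bigr => j _.
rewrite !mxE /cofactor /= add0n exprD.
have -> : row' ord0 (col' j (\matrix_(i < n.+1, l < n.+1) g (to_front b i) l))
  = row' (Ordinal bn) (col' j (\matrix_(i < n.+1, l < n.+1) g i l)).
  apply/matrixP=> i l; rewrite !mxE /to_front /= /bump /=.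
  by congr (g _ _); case: (leqP b i); case: leqP; lia.
rewrite -[g (to_front b 0) j]/(g b j); set d := \det _; set e := (-1) ^+ b.
have ee : e * e = 1 by rewrite -expr2 sqrr_sign.
by transitivity (e * e * (g b j * ((-1) ^+ j * d))); [rewrite ee mul1r|ring].
Qed.

(** Each of the r steps moves the last row to the front, a cycle of sign (-1)^(n-1). *)
Lemma ndet_rot n r g : (r <= n)%N ->
  ndet n (fun i j => g (if (i < r)%N then (n - r + i)%N else (i - r)%N) j)
  = (-1) ^+ (r * n.-1) * ndet n g.
Proof.
elim: r => [|r IHr] rn.
  rewrite mul0n expr0 mul1r; apply: eq_ndet => i j _ _; rewrite ltn0 subn0 //.
rewrite mulSn exprD -mulrA -IHr; last lia.
rewrite -(@ndet_to_front n n.-1); last lia.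
apply: eq_ndet => i j ni nj; congr (g _ _); rewrite /to_front.
case: (posnP i) => [->|i0] /=.
  by case: ltnP; lia.
rewrite (_ : (i <= n.-1)%N); last lia.
by case: ifP; case: ifP; lia.
Qed.

(* Complementary minors: multiply the matrix formed by the rows e_0, the columns
   of B and e_u (m < u) with the matrix formed by the columns of A and e_u
   (k < u); both factors and their product are block triangular, the last one
   after rotating its rows. *)
Lemma ndet_duality k m (A B : nat -> nat -> R) :
  (forall i s, (i <= k)%N -> (s < m)%N ->
     \sum_(u < k.+1 + m) A u i * B u s = 0) ->
  ndet k.+1 A * ndet m (fun s t => B s.+1 t)
  = (-1) ^+ (m * k)
    * ndet k.+1 (fun j i => A (if j == 0%N then 0%N else (m + j)%N) i)
    * ndet m (fun p s => B (k.+1 + p)%N s).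
Proof.
move=> AB0; pose n := (k.+1 + m)%N.
have kF s : (k.+1 + s < k)%N = false by lia.
have ks s : (k.+1 + s - k)%N = s.+1 by lia.
pose L u i : R := if (i < k.+1)%N then A u i else (u == i)%:R.
pose C r u : R := if (0 < r <= m)%N then B u r.-1 else (r == u)%:R.
have detL : ndet n L = ndet k.+1 A.
  rewrite ndet_lblock => [|i j ik jm]; last first.
    by rewrite /L ltnNge leq_addr /=; case: eqP => //; lia.
  rewrite -[RHS]mulr1 -(ndet_delta m); congr (_ * _); apply: eq_ndet => i j ik jk.
    by rewrite /L jk.
  by rewrite /L ltnNge leq_addr eqn_add2l.
have detC : ndet n C = ndet m (fun s t => B s.+1 t).
  rewrite {1}/n (_ : (k.+1 + m)%N = (1 + (m + k))%N); last lia.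
  rewrite ndet_lblock => [|i j ik jm]; last by rewrite /C; case: i ik.
  rewrite ndet_ublock => [|i j ik jm]; last first.
    by rewrite /C; case: ifP => [|_]; [lia|case: eqP => //; lia].
  rewrite -[RHS]mul1r -[RHS]mulr1 -mulrA; congr (_ * (_ * _)).
  - by rewrite -(ndet_delta 1); apply: eq_ndet => -[].
  - by rewrite -ndet_tr; apply: eq_ndet => i j im jm; rewrite /C /= jm.
  - rewrite -(ndet_delta k); apply: eq_ndet => i j im jm.
    by rewrite /C; case: ifP => [|_]; [lia|rewrite !eqn_add2l].
rewrite -detC -detL mulrC ndet_mul.
pose Z i j := \sum_(u < n) C i u * L u j.
have Zrow i j : (i < n)%N -> ~~ (0 < i <= m)%N -> Z i j = L i j.
  move=> ni im; rewrite /Z (bigD1 (Ordinal ni)) //= big1 => [|u].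
    by rewrite /C (negbTE im) eqxx mul1r addr0.
  by rewrite /C (negbTE im) -val_eqE eq_sym /= => /negbTE ->; rewrite mul0r.
have Z0 s i : (s < m)%N -> (i < k.+1)%N -> Z s.+1 i = 0.
  move=> sm ik; rewrite -[RHS](AB0 i s) //; apply: eq_bigr => u _.
  by rewrite /C /L /= sm ik mulrC.
have ZB s p : (s < m)%N -> (p < m)%N -> Z s.+1 (k.+1 + p)%N = B (k.+1 + p)%N s.
  move=> sm pm; have np : (k.+1 + p < n)%N by rewrite /n; lia.
  rewrite /Z (bigD1 (Ordinal np)) //= big1 => [|u]; last first.
    rewrite /L ltnNge leq_addr -val_eqE /= => /negbTE ->; exact: mulr0.
  by rewrite /L ltnNge leq_addr eqxx addr0 mulr1 /C /= sm.
(* The last k rows are rotated to the top. Rows 1, ..., m of [Z], which vanish in columns 0, ..., k,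
   then come last, and the matrix is block upper triangular. *)
have e1 : ndet n Z = (-1) ^+ (k * n.-1) *
    ndet n (fun i j => Z (if (i < k)%N then (n - k + i)%N else (i - k)%N) j).
  by rewrite ndet_rot ?mulrA -?expr2 ?sqrr_sign ?mul1r // /n; lia.
rewrite e1 ndet_ublock => [|s i sm ik]; last first.
  by rewrite kF ks Z0.
rewrite mulrA; congr (_ * _); last first.
  rewrite -ndet_tr; apply: eq_ndet => i s ik sm.
  by rewrite kF ks ZB.
(* Row 0 now stands at place k of the upper block. Moving it to the top costs (-1)^k, and k(k + m) +
   k has the parity of mk. *)
have := @ndet_to_front k.+1 k
  (fun i j => Z (if (i < k)%N then (n - k + i)%N else (i - k)%N) j) (ltnSn k).
move/(congr1 (fun z => (-1) ^+ k * z)); rewrite mulrA -expr2 sqrr_sign mul1r => <-.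
rewrite mulrA -exprD; congr (_ * _).
  rewrite /n -signr_odd -[RHS]signr_odd; congr (_ ^+ nat_of_bool _).
  by rewrite /= !(oddD, oddM); case: (odd k); case: (odd m).
apply: eq_ndet => i j ik jk; rewrite /to_front.
case: eqP => [_|/eqP i0].
  by rewrite ltnn subnn Zrow /L /= ?jk.
have [ik' i1k] : (i <= k)%N /\ (i.-1 < k)%N by lia.
have nki : (n - k + i.-1)%N = (m + i)%N by rewrite /n; lia.
by rewrite ik' i1k nki Zrow ?/L ?jk // /n; lia.
Qed.
End NatDet.

(** * Frobenius coordinates *)

Section FrobeniusCoordinates.
Local Open Scope nat_scope.

(* If l = (a1, a2, ... | b1, b2, ...) in Frobenius notation, then hook_add a b l
   is (a, a1, a2, ... | b, b1, b2, ...); hook_del removes the principal hook. *)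
Definition hook_add a b (l : seq nat) : seq nat :=
  a.+1 :: map S l ++ nseq (b - size l) 1.

Definition hook_del (l : seq nat) : seq nat :=
  [seq x.-1 | x <- behead l & 1 < x].

Lemma hook_addK a b l : all (ltn 0) l -> hook_del (hook_add a b l) = l.
Proof.
move=> l0; rewrite /hook_del /= filter_cat filter_nseq /= cats0.
elim: l l0 => //= x l IHl /andP [x0 l0].
by rewrite ltnS x0 /= IHl.
Qed.

Lemma size_hook_add a b l : size l <= b -> size (hook_add a b l) = b.+1.
Proof. by move=> lb; rewrite /= size_cat size_map size_nseq subnKC. Qed.

Lemma part_hook_addS a b l i : size l <= b -> i < b ->
  part (hook_add a b l) i.+2 = (part l i.+1).+1.
Proof.
move=> lb ib; rewrite /part /= nth_cat size_map; case: ltnP => il.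
  by rewrite (nth_map 0).
by rewrite nth_nseq (nth_default _ il) ifT //; lia.
Qed.

Lemma part_default l i : size l <= i -> part l i.+1 = 0.
Proof. exact: nth_default. Qed.

Lemma is_partition_cons x l :
  is_partition (x :: l) = [&& head 0 l <= x, 0 < x & is_partition l].
Proof.
rewrite /is_partition /=; case: l => [|y l] /=; first by rewrite !andbT.
by rewrite -!andbA; congr andb; rewrite andbCA.
Qed.

Lemma is_partition_hook_add a b l :
  head 0 l <= a -> is_partition l -> is_partition (hook_add a b l).
Proof.
rewrite /hook_add => la pl; rewrite is_partition_cons /=; apply/andP; split.
  by case: l la {pl} => [|x l] //=; case: (b - 0) => /=.
move: (b - _) => c; elim: l pl {la} => [|x l IHl].
  by elim: c => //= c IHc; rewrite is_partition_cons IHc; case: c {IHc}.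
rewrite !is_partition_cons /= => /and3P [lx x0 /IHl ->]; rewrite andbT.
by case: l lx {IHl} => [|y l] //=; case: c => /=.
Qed.

(** The parts equal to 1 all stand at the end, so dropping them and appending as many as the length
    demands restores the tail of the list. *)
Lemma is_partition_hook_del l : is_partition l ->
  [/\ is_partition (hook_del l), head 0 (hook_del l) <= (head 0 l).-1,
      size (hook_del l) <= (size l).-1
    & l != [::] -> l = hook_add (head 0 l).-1 (size l).-1 (hook_del l)].
Proof.
case: l => [|x l] //; rewrite is_partition_cons => /and3P [lx x0 pl].
rewrite /hook_del /hook_add /= size_map size_filter count_size.
suff [h1 h2 h3] : [/\ is_partition [seq x.-1 | x <- l & 1 < x],
    head 0 [seq x.-1 | x <- l & 1 < x] <= (head 0 l).-1
  & l = [seq x.+1 | x <- [seq x.-1 | x <- l & 1 < x]]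
         ++ nseq (size l - count (ltn 1) l) 1].
  split=> // [|_]; first by apply: leq_trans h2 _; lia.
  by rewrite prednK // -h3.
elim: l pl {x lx x0} => [|x l IHl] //; rewrite is_partition_cons.
case/and3P => lx x0 /IHl [h1 h2 h3] /=; case: ltnP => x1 /=.
  split=> //; last by rewrite prednK // subSS -h3.
  rewrite is_partition_cons h1 andbT; apply/andP; split; last lia.
  by apply: leq_trans h2 _; lia.
have {x1 x0}x1 : x = 1 by lia.
subst x; have : size [seq x.-1 | x <- l & 1 < x] = count (ltn 1) l.
  by rewrite size_map size_filter.
case: [seq x.-1 | x <- l & 1 < x] h1 h2 h3 => [|y f] h1 _ h3 /=.
  by move=> c0; rewrite -c0 /= in h3 *; rewrite {1}h3 subn0.
move: h1 lx; rewrite h3 is_partition_cons /= => /and3P [_ y0 _]; lia.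
Qed.

Lemma rk_leqP l n :
  reflect (forall r, 0 < r -> r <= part l r -> r <= n) (rk l <= n).
Proof.
apply: (iffP (bigmax_leqP_seq _ _ _ _)) => h r.
  move=> r0 rl; apply: h; rewrite // mem_index_iota r0 ltnS leqNgt.
  by apply/negP; case: r r0 rl => // r _ rl lr; move: rl; rewrite part_default.
by rewrite mem_index_iota => /andP [r0 _]; apply: h.
Qed.

(** Row 1 always meets the rank condition, and for r < b the condition in row r + 2 of the new
    partition is the condition in row r + 1 of [l]. *)
Lemma rk_hook_add a b l : size l <= b -> rk (hook_add a b l) = (rk l).+1.
Proof.
move=> lb; apply/eqP; rewrite eqn_leq; apply/andP; split.
  apply/rk_leqP => -[|[|r]] // _.
  have [rb|br] := ltnP r b; last by rewrite part_default ?size_hook_add.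
  rewrite part_hook_addS // !ltnS => rl.
  by have /rk_leqP := leqnn (rk l); apply.
case E : (rk (hook_add a b l)) => [|n].
  by have /rk_leqP /(_ 1 isT) := eq_leq E; rewrite /part /= => /(_ isT).
rewrite ltnS; apply/rk_leqP => -[|r] // _ rl.
have rb : r < b.
  by rewrite ltnNge; apply: contraL rl => br; rewrite part_default // (leq_trans lb).
have /rk_leqP /(_ r.+2 isT) := eq_leq E.
by rewrite part_hook_addS // !ltnS; apply.
Qed.

Lemma rk_leq_size l : rk l <= size l.
Proof.
apply/rk_leqP => -[|r] // _ rl; rewrite ltnNge; apply: contraL rl => lr.
by rewrite part_default.
Qed.

Lemma part_leq_head l i : is_partition l -> part l i <= head 0 l.
Proof.
rewrite /part; elim: l (i.-1) => [|x l IHl] [|j] //.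
rewrite is_partition_cons => /and3P [lx _ /IHl h].
exact: leq_trans (h j) lx.
Qed.

Lemma rk_leq_head l : is_partition l -> rk l <= head 0 l.
Proof.
by move=> pl; apply/rk_leqP => r _ /leq_trans; apply; apply: part_leq_head.
Qed.

Lemma frob_arm_hook_add a b l : size l <= b ->
  frob_arm (hook_add a b l) = a :: frob_arm l.
Proof.
move=> lb; rewrite /frob_arm rk_hook_add //= subn1; congr (_ :: _).
rewrite (iotaDl 1 1) -map_comp; apply/eq_in_map => -[|i].
  by rewrite mem_iota.
rewrite mem_iota add1n ltnS => /= il.
by rewrite add1n part_hook_addS //; have := rk_leq_size l; lia.
Qed.

Lemma frob_leg_hook_add a b l : is_partition l -> size l <= b -> head 0 l <= a ->
  frob_leg (hook_add a b l) = b :: frob_leg l.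
Proof.
move=> pl lb la.
have c1 : conj_part (hook_add a b l) 1 = b.+1.
  rewrite -(size_hook_add a lb); apply/eqP; rewrite -all_count.
  by have /andP [] := is_partition_hook_add b la pl.
rewrite /frob_leg rk_hook_add // [iota _ _]/= map_cons c1 subn1; congr (_ :: _).
rewrite (iotaDl 1 1) -map_comp; apply/eq_in_map => i.
rewrite mem_iota add1n ltnS => /andP [i0 il] /=.
(* The new first row reaches column i + 1 because i <= a, while the added parts 1 do not. *)
have ia : i <= a by rewrite (leq_trans il) // (leq_trans (rk_leq_head pl)).
rewrite add1n /conj_part /= ltnS ia count_cat count_nseq.
rewrite (_ : (i < 1) = false); last lia.
rewrite mul0n addn0 add1n subSS count_map.
by congr (_ - _); apply: eq_count.
Qed.

Lemma frob_nil : (frob_arm [::] = [::]) * (frob_leg [::] = [::]).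
Proof. by rewrite /frob_arm /frob_leg /rk big_geq. Qed.

Lemma sumn_hook_add a b l : size l <= b -> sumn (hook_add a b l) = sumn l + a + b + 1.
Proof.
move=> lb; rewrite /hook_add /= sumn_cat sumn_nseq mul1n.
suff -> : sumn (map S l) = sumn l + size l by lia.
by elim: l {lb} => //= x l ->; lia.
Qed.

(* The partitions (alpha + c, d | alpha, 0) with all entries of alpha at most b. *)
Fixpoint frob_list c d b : seq (seq nat) :=
  if b is b'.+1 then
    frob_list c d b' ++ [seq hook_add (b + c) b l | l <- frob_list c d b']
  else [:: [:: d.+1]].

Lemma frob_list_bound c d b l : d <= c -> l \in frob_list c d b ->
  [/\ is_partition l, size l <= b.+1 & head 0 l <= (b + c).+1].
Proof.
move=> dc; elim: b l => [|b IHb] l /=.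
  by rewrite inE => /eqP -> /=; split.
rewrite mem_cat => /orP [/IHb [pl sl hl]|/mapP [l' /IHb [pl sl hl] ->]].
  by split; [|exact: leqW|exact: leqW].
by rewrite size_hook_add //; split=> //; apply: is_partition_hook_add.
Qed.

Lemma uniq_frob_list c d b : d <= c -> uniq (frob_list c d b).
Proof.
move=> dc; elim: b => //= b IHb; rewrite cat_uniq IHb /=; apply/andP; split.
  (* The old partitions have at most b + 1 parts, the new ones exactly b + 2. *)
  apply/hasPn => _ /mapP [l /(frob_list_bound dc) [_ lb _] ->].
  by apply/negP => /(frob_list_bound dc) [_]; rewrite size_hook_add // ltnn.
rewrite map_inj_in_uniq // => l1 l2 /(frob_list_bound dc) [/andP [_ p1] _ _].
move=> /(frob_list_bound dc) [/andP [_ p2] _ _] /(congr1 hook_del).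
by rewrite !hook_addK.
Qed.

Lemma frob_list_sub c d b b' : b <= b' -> {subset frob_list c d b <= frob_list c d b'}.
Proof.
move/subnK <-; elim: (b' - b) => // n IHn l /IHn.
by rewrite addSn /= mem_cat => ->.
Qed.

Lemma frob_list_shape c d b l : d <= c -> l \in frob_list c d b -> frob_shape c d l.
Proof.
move=> dc; suff h : l \in frob_list c d b -> is_partition l /\
    exists alpha : seq nat,
       [/\ sorted gtn alpha, all (ltn 0) alpha, head 0 alpha <= b,
           frob_arm l = rcons [seq a + c | a <- alpha] d
         & frob_leg l = rcons alpha 0].
  by move/h => [pl [al [*]]]; split=> //; exists al; split.
elim: b l => [|b IHb] l /=.
  rewrite inE => /eqP ->; split=> //; exists [::].
  have [sz h0] : size ([::] : seq nat) <= 0 /\ head 0 ([::] : seq nat) <= d by [].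
  have e : [:: d.+1] = hook_add d 0 [::] by [].
  by rewrite e frob_arm_hook_add ?frob_leg_hook_add // !frob_nil.
rewrite mem_cat => /orP [/IHb [pl [al [h1 h2 h3 h4 h5]]]|].
  by split=> //; exists al; split=> //; lia.
move=> /mapP [l' l'b ->]; have [pl sl hl] := frob_list_bound dc l'b.
have [_ [al [h1 h2 h3 h4 h5]]] := IHb _ l'b.
split; first exact: is_partition_hook_add.
exists (b.+1 :: al); split=> //=.
- by case: al h1 h3 {h2 h4 h5} => //= x al -> xb; rewrite andbT.
- by rewrite frob_arm_hook_add // h4.
- by rewrite frob_leg_hook_add // h5.
Qed.

(** Induction on [alpha], removing the principal hook. The first leg is [(size l).-1], so the bound
    on the length bounds all entries of [alpha]. *)
Lemma mem_frob_list c d b l : d <= c -> size l <= b.+1 -> frob_shape c d l ->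
  l \in frob_list c d b.
Proof.
move=> dc lb [pl [al [h1 h2 h3 h4]]].
have := is_partition_hook_del pl.
elim: al l b pl lb h1 h2 h3 h4 => [|x al IHal] l b pl lb /= h1 h2 h3 h4.
  case=> pl' hl' sl' lE; have {}lE : l = hook_add (head 0 l).-1 (size l).-1 (hook_del l).
    by apply: lE; apply/eqP => l0; rewrite l0 frob_nil in h3.
  move: h3 h4; rewrite lE frob_arm_hook_add // frob_leg_hook_add // -lE.
  case=> hd _ [s0 _]; apply: (frob_list_sub (leq0n b)); rewrite inE lE hd s0.
  by move: sl'; rewrite s0 leqn0 => /nilP ->.
case=> pl' hl' sl' lE; have {}lE : l = hook_add (head 0 l).-1 (size l).-1 (hook_del l).
  by apply: lE; apply/eqP => l0; rewrite l0 frob_nil in h3.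
move: h3 h4; rewrite lE frob_arm_hook_add // frob_leg_hook_add // -lE.
case=> hd h3 [sx h4]; have /andP [x0 al0] := h2.
have xb : x.-1.+1 <= b by lia.
apply: (frob_list_sub xb); rewrite /= mem_cat; apply/orP; right; apply/mapP.
exists (hook_del l); last by rewrite prednK // -hd -sx.
apply: IHal => //; last exact: is_partition_hook_del.
  by rewrite prednK // -sx.
exact: path_sorted h1.
Qed.

(** Replaces the sum over an infinite set by a sum over a list; it is applied with b = k to Schur
    polynomials in k + 1 variables, which vanish on longer partitions. *)
Lemma sum_frob_shape (V : nmodType) c d b (F : seq nat -> V) : d <= c ->
  (forall l, b.+1 < size l -> F l = 0%R) ->
  (\sum_(l \in frob_shape c d) F l = \sum_(l <- frob_list c d b) F l)%R.
Proof.
move=> dc F0; rewrite [RHS]fsbig_seq ?uniq_frob_list //; apply/esym/fsbig_widen.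
  by move=> l /= /(frob_list_shape dc).
move=> l /= [sl nl]; apply: F0; rewrite ltnNge; apply/negP => lb.
by apply: nl; rewrite mem_frob_list.
Qed.

(** The two shapes are disjoint: the last arm is d in one and d' in the other. *)
Lemma sum_frob_shapeU (V : nmodType) c d d' b (F : seq nat -> V) :
  d <= c -> d' <= c -> d != d' ->
  (forall l, b.+1 < size l -> F l = 0%R) ->
  (\sum_(l \in (frob_shape c d `|` frob_shape c d')%classic) F l =
   \sum_(l <- frob_list c d b) F l + \sum_(l <- frob_list c d' b) F l)%R.
Proof.
move=> dc d'c dd' F0; rewrite -big_cat [RHS]fsbig_seq; last first.
  rewrite cat_uniq !uniq_frob_list // andbT; apply/hasPn => l /(frob_list_shape d'c).
  move=> [_ [al [_ _ h1 _]]]; apply/negP => /(frob_list_shape dc) [_ [al' [_ _ h2 _]]].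
  move: h1; rewrite h2 => /rcons_inj [] _ /eqP; exact/negP.
apply/esym/fsbig_widen.
  move=> l /=; rewrite mem_cat => /orP [] h; [left|right]; exact: frob_list_shape h.
move=> l /= [sl nl]; apply: F0; rewrite ltnNge; apply/negP => lb; apply: nl.
by case: sl => sl; rewrite mem_cat (mem_frob_list _ _ sl) ?orbT.
Qed.

End FrobeniusCoordinates.

(** * Signed sums of alternants over one Frobenius shape *)

Section AlternantSum.
Variables (R : comNzRingType) (x : nat -> R).

(** Transposed with respect to [alternant]: the parts index the rows, so that adding a hook acts on
    rows. *)
Definition nalternant k (l : seq nat) : R :=
  ndet k (fun j i => x i ^+ (part l j.+1 + (k - j.+1))).

(* Adding the hook with leg b.+1 replaces the exponent k - b.+2 in row b.+1 by
   k + c + b.+1, up to a cycle of sign (-1) ^+ b.+1 that sorts the latter to the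
   front; the rows below b are kept arbitrary (h) so that the induction on b
   can modify them one at a time. *)
Lemma sum_nalternant_rows k c d b (sg : R) (w : seq nat -> R) (h : nat -> nat -> R) :
  (d <= c)%N -> (b < k)%N ->
  (forall b l, l \in frob_list c d b ->
     w (hook_add (b.+1 + c) b.+1 l) = (-1) ^+ b.+1 * sg * w l) ->
  \sum_(l <- frob_list c d b)
    w l * ndet k (fun j i =>
      if (j <= b)%N then x i ^+ (part l j.+1 + (k - j.+1)) else h j i)
  = w [:: d.+1] * ndet k (fun j i =>
      if j == 0%N then x i ^+ (k + d)
      else if (j <= b)%N then x i ^+ (k - j.+1) + sg * x i ^+ (k + c + j)
      else h j i).
Proof.
move=> dc bk wS; elim: b h bk => [|b IHb] h bk.
  rewrite big_seq1; congr (_ * _); apply: eq_ndet => j i jk ik.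
  by case: j jk => [|j] jk //=; congr (_ ^+ _); rewrite /part /=; lia.
rewrite /= big_cat big_map /= -big_split /=.
(* The induction hypothesis is used with row b + 1 already in its final two-term form; linearity in
   that row then separates [l] from [l] with a hook added. *)
pose h' j i := if j == b.+1 then x i ^+ (k - j.+1) + sg * x i ^+ (k + c + j)
               else h j i.
transitivity (w [:: d.+1] * ndet k (fun j i =>
      if j == 0%N then x i ^+ (k + d)
      else if (j <= b)%N then x i ^+ (k - j.+1) + sg * x i ^+ (k + c + j)
      else h' j i)); last first.
  congr (_ * _); apply: eq_ndet => j i jk ik; rewrite /h'.
  rewrite [(j <= b.+1)%N]leq_eqVlt ltnS; case: (j =P b.+1) => [->|_] //=.
  by rewrite ltnn.
rewrite -IHb; last lia.
apply: eq_big_seq => l lb; have [pl sl hl] := frob_list_bound dc lb.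
rewrite wS //; set D1 := (X in _ * X + _); set D2 := (X in _ + _ * X).
rewrite (_ : _ + _ = w l * (D1 + sg * ((-1) ^+ b.+1 * D2))); last by ring.
congr (_ * _).
pose g (a : nat -> R) j i :=
  if j == b.+1 then a i else
  if (j <= b)%N then x i ^+ (part l j.+1 + (k - j.+1)) else h j i.
transitivity (ndet k (g (fun i => x i ^+ (k - b.+2) + sg * x i ^+ (k + c + b.+1)))); last first.
  apply: eq_ndet => j i jk ik; rewrite /g /h'.
  by case: eqP => [->|//]; rewrite ltnn.
rewrite ndet_row_linear //; congr (_ + _ * _).
  apply: eq_ndet => j i jk ik; rewrite leq_eqVlt ltnS.
  by case: eqP => [->|//]; rewrite /= part_default.
(* Adding the hook raises every old part by one and moves it down one row, which preserves its
   exponent; only the new row 0, of exponent k + c + b + 1, is out of place. *)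
have -> : D2 = (-1) ^+ b.+1 * ndet k (g (fun i => x i ^+ (k + c + b.+1))); last first.
  by rewrite mulrA -expr2 sqrr_sign mul1r.
rewrite -ndet_to_front //; apply: eq_ndet => j i jk ik.
rewrite /to_front /g; case: j jk => [|j] jk.
  by rewrite /= eqxx /part /=; congr (_ ^+ _); lia.
rewrite /= ltnS; case: (leqP j b) => jb.
  rewrite part_hook_addS // ifF; last lia.
  by rewrite jb; congr (_ ^+ _); lia.
by rewrite !ifF //; lia.
Qed.

Lemma sum_nalternant k c d (sg : R) (w : seq nat -> R) :
  (d <= c)%N ->
  (forall b l, l \in frob_list c d b ->
     w (hook_add (b.+1 + c) b.+1 l) = (-1) ^+ b.+1 * sg * w l) ->
  \sum_(l <- frob_list c d k) w l * nalternant k.+1 l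
  = w [:: d.+1] * ndet k.+1 (fun j i =>
      if j == 0%N then x i ^+ (k.+1 + d)
      else x i ^+ (k - j) + sg * x i ^+ (k.+1 + c + j)).
Proof.
move=> dc wS; have := @sum_nalternant_rows k.+1 c d k sg w (fun _ _ => 0) dc (ltnSn k) wS.
set S := (X in _ = X) => h.
transitivity S; [rewrite -h|congr (_ * _)].
  by apply: eq_bigr => l _; congr (_ * _); apply: eq_ndet => j i; rewrite ltnS => ->.
by apply: eq_ndet => j i; rewrite ltnS => ->.
Qed.
End AlternantSum.

(** * The kernel of the evaluations *)

Section BilateralKernel.
Variables (R : comNzRingType) (k : nat) (g : int -> R).
Hypothesis g_even : forall z, g (- z) = g z.
Hypothesis g_supp : forall z, (k < `|z|)%N -> g z = 0.

Lemma sum_bilateral_shift x n M :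
  \sum_(j < (2 * k).+1) g (j%:Z - k%:Z) * x ^+ j = 0 ->
  (n + (2 * k).+1 <= M)%N ->
  \sum_(j < M) g (j%:Z - n%:Z - k%:Z) * x ^+ j = 0.
Proof.
move=> g0 nM; rewrite -(big_mkord xpredT (fun j => g (j%:Z - n%:Z - k%:Z) * x ^+ j)).
rewrite (big_cat_nat (n := n)) //=; last lia.
rewrite (big_cat_nat (n := (n + (2 * k).+1)%N) (m := n)) //=; last lia.
rewrite big_nat big1 => [|j jn]; last by rewrite g_supp ?mul0r //; lia.
rewrite add0r [X in _ + X]big_nat [X in _ + X]big1 => [|j jn]; last first.
  by rewrite g_supp ?mul0r //; lia.
rewrite addr0 -{1}[n]add0n big_addn addKn big_mkord.
transitivity (x ^+ n * \sum_(j < (2 * k).+1) g (j%:Z - k%:Z) * x ^+ j); last first.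
  by rewrite g0 mulr0.
rewrite mulr_sumr; apply: eq_bigr => j _; rewrite exprD.
have -> : (j + n)%N%:Z - n%:Z - k%:Z = j%:Z - k%:Z by lia.
by ring.
Qed.

Variables (tau : R) (kap : nat).

(* The coefficients, in the basis x^-u + tau * x^(u + kap), of the product of
   x^-s + tau * x^(s + kap) by the even Laurent polynomial with coefficients g
   (for kap = 0 the basis vector of index 0 is 1 instead of 2). *)
Definition kernel_coef u s := g (u%:Z - s%:Z) + tau * g (u%:Z + s%:Z + kap%:Z).

(** With G the Laurent polynomial of coefficients [g], this expands x^(k+m-1) (x^-s + tau x^(s+kap))
    G(x) = 0. The first sum collects the exponents below k + m in reverse order, the second the
    others. *)
Lemma sum_kernel_coef x m s : (s < m)%N -> (0 < k)%N ->
  \sum_(j < (2 * k).+1) g (j%:Z - k%:Z) * x ^+ j = 0 ->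
  \sum_(u < k + m) kernel_coef u s * x ^+ (k + m - u.+1)
  + \sum_(j < k + m + kap - 1)
      (g ((s + j).+1%:Z) + tau * g (j.+1%:Z - s%:Z - kap%:Z)) * x ^+ (k + m + j) = 0.
Proof.
move=> sm k0 g0.
pose c j := g (j%:Z - (m - s.+1)%N%:Z - k%:Z)
            + tau * g (j%:Z - (m + s + kap - 1)%N%:Z - k%:Z).
have : \sum_(j < (k + m) + (k + m + kap - 1)) c j * x ^+ j = 0.
  under eq_bigr => j _ do rewrite mulrDl -mulrA.
  rewrite big_split /= -mulr_sumr !sum_bilateral_shift ?mulr0 ?addr0 //; lia.
rewrite big_split_ord /= => h; rewrite -[RHS]h; congr (_ + _).
  rewrite [RHS](reindex_inj rev_ord_inj) /=; apply: eq_bigr => u _.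
  congr (_ * _).
  rewrite /c /kernel_coef; congr (_ + _ * _).
    by rewrite -[LHS]g_even; congr (g _); have := ltn_ord u; lia.
  by rewrite -[LHS]g_even; congr (g _); have := ltn_ord u; lia.
apply: eq_bigr => j _; congr (_ * _); rewrite /c; congr (_ + _ * _); congr (g _); lia.
Qed.

End BilateralKernel.

(** For tau = -1 and kap = 1 the coefficient of x^(u+1) is minus that of x^-u, so the two sums of
    [sum_kernel_coef] merge term by term. The next two lemmas use the same symmetry about another
    centre. *)
Lemma kernel_relation_odd (R : comNzRingType) k (g : int -> R) x m s :
  (forall z, g (- z) = g z) -> (forall z, (k < `|z|)%N -> g z = 0) ->
  (s < m)%N -> (0 < k)%N ->
  \sum_(j < (2 * k).+1) g (j%:Z - k%:Z) * x ^+ j = 0 ->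
  \sum_(u < k + m) (x ^+ (k + m - u.+1) - x ^+ (k + m + u))
                   * kernel_coef g (-1) 1 u s = 0.
Proof.
move=> ge gs sm k0 g0; rewrite -[RHS](sum_kernel_coef ge gs (-1) 1 sm k0 g0).
rewrite addnK -big_split; apply: eq_bigr => u _ /=.
rewrite /kernel_coef (_ : u.+1%:Z - s%:Z - 1%:Z = u%:Z - s%:Z); last lia.
rewrite (_ : (s + u).+1%:Z = u%:Z + s%:Z + 1%:Z); last lia.
by ring.
Qed.

Lemma kernel_relation_symplectic (R : comNzRingType) k (g : int -> R) x m s :
  (forall z, g (- z) = g z) -> (forall z, (k < `|z|)%N -> g z = 0) ->
  (s < m)%N -> (0 < k)%N ->
  \sum_(j < (2 * k).+1) g (j%:Z - k%:Z) * x ^+ j = 0 ->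
  \sum_(u < k + m) (x ^+ (k + m - u.+1) - x ^+ (k + m + u.+1))
                   * kernel_coef g (-1) 2 u s = 0.
Proof.
move=> ge gs sm k0 g0; rewrite -[RHS](sum_kernel_coef ge gs (-1) 2 sm k0 g0).
rewrite addn2 subn1 big_ord_recl /=.
(* The central power x^(k+m) is its own mirror image, so antisymmetry makes its coefficient 0. *)
rewrite (_ : 1%:Z - s%:Z - 2%:Z = - (s + 0).+1%:Z) ?ge; last lia.
rewrite addn0 mulN1r subrr mul0r add0r -big_split; apply: eq_bigr => u _ /=.
rewrite /kernel_coef /bump add1n (_ : u.+2%:Z - s%:Z - 2%:Z = u%:Z - s%:Z); last lia.
rewrite (_ : (s + u.+1).+1%:Z = u%:Z + s%:Z + 2%:Z); last lia.
by ring.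
Qed.

Lemma kernel_relation_even (R : comNzRingType) k (g : int -> R) x m s :
  (forall z, g (- z) = g z) -> (forall z, (k < `|z|)%N -> g z = 0) ->
  (s < m)%N -> (0 < k)%N ->
  \sum_(j < (2 * k).+1) g (j%:Z - k%:Z) * x ^+ j = 0 ->
  \sum_(u < k + m) (if u == 0%N :> nat then x ^+ (k + m - 1)
                    else x ^+ (k + m - u.+1) + x ^+ (k + m - 1 + u))
                   * kernel_coef g 1 0 u s = 0.
Proof.
move=> ge gs sm k0 g0; rewrite -[RHS](sum_kernel_coef ge gs (1) 0 sm k0 g0).
(* The central power is now x^(k+m-1): it belongs to u = 0 and has no partner in the second sum. *)
rewrite addn0 -(@prednK (k + m)); last lia.
rewrite subn1 /= !big_ord_recl /= -addrA -big_split /=; congr (_ + _).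
  by rewrite subn1 mulrC.
apply: eq_bigr => u _; rewrite /bump /= !add1n.
rewrite /kernel_coef subr0 (_ : (s + u).+1%:Z = u.+1%:Z + s%:Z); last lia.
rewrite (_ : (_ + u.+1)%N = ((k + m).-1.+1 + u)%N); last lia.
rewrite addr0; by ring.
Qed.

(** * Vandermonde determinants in x + 1/x *)

Section Weyl.
Variable F : fieldType.

Lemma prod_pairs k (b : nat -> F) :
  \prod_(i < k) \prod_(j < k | (i < j)%N) (b i * b j) = \prod_(i < k) b i ^+ k.-1.
Proof.
under eq_bigr => i _ do rewrite big_split /=.
rewrite big_split /= [X in _ * X](exchange_big_dep xpredT) //= -big_split /=.
apply: eq_bigr => i _; 
have -> : k.-1 = #|predC1 i| by rewrite cardC1 card_ord.
rewrite -prodr_const.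
rewrite [RHS](bigID (fun j : 'I_k => (i < j)%N)) /=; congr (_ * _);
  apply: eq_bigl => j; rewrite !inE -val_eqE /=; case: ltngtP => //.
Qed.

(** Monic polynomials of degrees 0, ..., k - 1 are related to the monomials by a unitriangular
    matrix, so this is a Vandermonde determinant in a_i / b_i; the powers of b_i supply one factor
    b_i b_j per pair and clear denominators. *)
Lemma ndet_homogeneous k (p : nat -> {poly F}) (a b : nat -> F) :
  (forall u, p u \is monic) -> (forall u, size (p u) = u.+1) ->
  (forall i, (i < k)%N -> b i != 0) ->
  ndet k (fun u i => b i ^+ k.-1 * (p u).[a i / b i])
  = \prod_(i < k) \prod_(j < k | (i < j)%N) (a j * b i - a i * b j).
Proof.
move=> pm ps b0.
transitivity (ndet k (fun u i => 1 * b i ^+ k.-1 * (p u).[a i / b i])).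
  by apply: eq_ndet => u i _ _; rewrite mul1r.
rewrite (ndet_scale k (fun=> 1) (fun i => b i ^+ k.-1) (fun u i => (p u).[a i / b i])).
rewrite big1 // mul1r -prod_pairs.
have -> : ndet k (fun u i => (p u).[a i / b i])
  = \prod_(i < k) \prod_(j < k | (i < j)%N) (a j / b j - a i / b i).
  transitivity (ndet k (fun u v => (p u)`_v) * ndet k (fun v i => (a i / b i) ^+ v)).
    rewrite ndet_mul; apply: eq_ndet => u i uk ik.
    by rewrite (horner_coef_wide (n := k)) // ps.
  rewrite [X in X * _](_ : _ = 1) ?mul1r; last first.
    rewrite /ndet det_trig; last first.
      by apply/is_trig_mxP => u v uv; rewrite mxE nth_default // ps.
    by apply: big1 => u _; rewrite mxE; have /monicP := pm u; rewrite lead_coefE ps.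
  transitivity (\det (Vandermonde k (\row_(i < k) (a i / b i)))).
    by congr (\det _); apply/matrixP=> u i; rewrite !mxE.
  rewrite det_Vandermonde; apply: eq_bigr => i _; apply: eq_bigr => j _.
  by rewrite !mxE.
rewrite -big_split; apply: eq_bigr => i _; rewrite -big_split; apply: eq_bigr => j _ /=.
by field; rewrite !b0.
Qed.

(* Chebyshev polynomials in y = x + 1 / x, monic: x^-u +- x^(u + kap) is
   w * (cheb gam e u).[y] for 0 < u, whereas its value at u = 0 is e * w; one has
   e = 2 when kap = 0 and e = 1 otherwise. *)
Fixpoint cheb (gam e : F) (u : nat) : {poly F} :=
  match u with
  | 0 => 1
  | 1 => 'X + gam%:P
  | (u2.+1 as u1).+1 => cheb gam e u1 * 'X - (if u2 is 0%N then e else 1) *: cheb gam e u2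
  end.

Lemma chebSS gam e u :
  cheb gam e u.+2 = cheb gam e u.+1 * 'X - (if u is 0%N then e else 1) *: cheb gam e u.
Proof. by []. Qed.

Lemma chebSSS gam e u :
  cheb gam e u.+3 = cheb gam e u.+2 * 'X - cheb gam e u.+1.
Proof. by rewrite chebSS scale1r. Qed.

Lemma cheb_monic_size gam e u :
  cheb gam e u \is monic /\ size (cheb gam e u) = u.+1.
Proof.
suff : (cheb gam e u \is monic /\ size (cheb gam e u) = u.+1) /\
       (cheb gam e u.+1 \is monic /\ size (cheb gam e u.+1) = u.+2) by case.
elim: u => [|u [[m0 s0] [m1 s1]]].
  split; first by rewrite monic1 size_poly1.
  by rewrite /= -[gam]opprK polyCN monicXsubC size_XsubC.
split; first by [].
have sX : size (cheb gam e u.+1 * 'X) = u.+3.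
  by rewrite size_mulX ?s1 // monic_neq0.
have sl : (size (- ((if u is 0%N then e else 1%R) *: cheb gam e u)) < size (cheb gam e u.+1 * 'X)%R)%N.
  rewrite size_polyN sX (leq_ltn_trans (size_scale_leq _ _)) // s0; lia.
rewrite chebSS; split; last by rewrite size_polyDl.
by rewrite monicE lead_coefDl // lead_coefMX -monicE.
Qed.

Lemma cheb_eval gam e w y (H : nat -> F) :
  H 0%N = e * w -> H 1%N = w * (y + gam) ->
  (forall u, H u.+2 = y * H u.+1 - H u) ->
  forall u, H u.+1 = w * (cheb gam e u.+1).[y].
Proof.
move=> h0 h1 hS.
have h1' : H 1%N = w * (cheb gam e 1).[y] by rewrite h1 /= hornerD hornerX hornerC.
suff h u : H u.+1 = w * (cheb gam e u.+1).[y] /\ H u.+2 = w * (cheb gam e u.+2).[y].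
  by move=> u; case: (h u).
elim: u => [|u [IH0 IH1]].
  split=> //; rewrite hS h1 h0 /= hornerD hornerN hornerZ hornerMX hornerD hornerX !hornerC.
  by ring.
split=> //; rewrite hS IH1 IH0 chebSSS.
move: (cheb gam e u.+2) (cheb gam e u.+1) => P Q.
by rewrite hornerD hornerN hornerMX; ring.
Qed.

End Weyl.

(** * Complementary minors with the constant factors evaluated *)

Section DualDeterminant.
Variables (F : fieldType) (k m : nat) (x : nat -> F).
Hypothesis x_neq0 : forall i, (i <= k)%N -> x i != 0.

(** Each factor equals (x_i - x_j)(1 - x_i x_j), the numerator of y_j - y_i for y = x + 1/x. *)
Definition weyl : F :=
  \prod_(i < k.+1) \prod_(j < k.+1 | (i < j)%N)
    ((1 + x j ^+ 2) * x i - (1 + x i ^+ 2) * x j).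

(** In [ndet_duality] the first k + 1 rows of [A] give a Vandermonde determinant times X^m prod w_i,
    with X = prod x_i, and the last m rows of [B] are triangular with diagonal [eta s * gk]. The
    power X^m then cancels. *)
Lemma dual_determinant (w eta : nat -> F) (gk : F) (p : nat -> {poly F})
    (A B : nat -> nat -> F) :
  (forall u, p u \is monic) -> (forall u, size (p u) = u.+1) ->
  gk = (-1) ^+ k.+1 * \prod_(i < k.+1) x i ->
  (forall u i, (u <= k)%N -> (i <= k)%N ->
     A u i = w i * x i ^+ (k + m) * (p u).[(1 + x i ^+ 2) / x i]) ->
  (forall i s, (i <= k)%N -> (s < m)%N ->
     \sum_(u < k.+1 + m) A u i * B u s = 0) ->
  (forall r s, (s < r < m)%N -> B (k.+1 + r)%N s = 0) ->
  (forall s, (s < m)%N -> B (k.+1 + s)%N s = eta s * gk) ->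
  (\prod_(s < m) eta s)
    * ndet k.+1 (fun j i => A (if j == 0%N then 0%N else (m + j)%N) i)
  = (-1) ^+ m * (\prod_(i < k.+1) w i) * weyl * ndet m (fun s t => B s.+1 t).
Proof.
move=> pm ps gkE AE AB0 B0 BE; have := ndet_duality AB0.
have -> : ndet k.+1 A = (\prod_(i < k.+1) w i) * (\prod_(i < k.+1) x i) ^+ m * weyl.
  transitivity (ndet k.+1 (fun u i =>
      1 * (w i * x i ^+ m) * (x i ^+ k * (p u).[(1 + x i ^+ 2) / x i]))).
    by apply: eq_ndet => u i uk ik; rewrite AE // exprD; ring.
  rewrite (ndet_scale _ (fun=> 1) (fun i => w i * x i ^+ m)
    (fun u i => x i ^+ k * (p u).[(1 + x i ^+ 2) / x i])).
  rewrite big1 // mul1r big_split /= prodrXl; congr (_ * _).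
  exact: (ndet_homogeneous (k := k.+1) (fun i => 1 + x i ^+ 2) pm ps x_neq0).
have -> : ndet m (fun r s => B (k.+1 + r)%N s) = (\prod_(s < m) eta s) * gk ^+ m.
  rewrite -ndet_tr /ndet det_trig; last first.
    by apply/is_trig_mxP => i j ij; rewrite mxE B0 // ij ltn_ord.
  under eq_bigr => s _ do rewrite mxE BE //.
  by rewrite big_split /= prodr_const card_ord.
rewrite gkE; set X := \prod_(i < k.+1) x i; set W := \prod_(i < k.+1) w i.
set D := ndet _ _; set H := \prod_(s < m) eta s; set J := ndet _ _.
have X0 : X ^+ m != 0.
  by rewrite expf_neq0 //; apply/prodf_neq0 => i _; rewrite x_neq0 // -ltnS.
(* The exponent m + mk + (k + 1)m is even. *)
have sg : (-1) ^+ m * (-1) ^+ (m * k) * ((-1) ^+ k.+1) ^+ m = 1 :> F.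
  rewrite -exprM -!exprD -signr_odd.
  by rewrite !(oddD, oddM) /=; case: (odd m); case: (odd k).
move=> h; apply: (mulfI X0).
transitivity ((-1) ^+ m * (W * X ^+ m * weyl * D)); last by ring.
rewrite h exprMn.
transitivity ((-1) ^+ m * (-1) ^+ (m * k) * (-1) ^+ k.+1 ^+ m * (X ^+ m * (H * J))).
  by rewrite sg mul1r.
by ring.
Qed.

End DualDeterminant.

(** * The dual determinants for kap = 1, 2, 0 *)

Section Cases.
Variables (F : fieldType) (k m : nat) (x : nat -> F) (g : int -> F).
Hypothesis x_neq0 : forall i, (i <= k)%N -> x i != 0.
Hypothesis g_even : forall z, g (- z) = g z.
Hypothesis g_supp : forall z, (k.+1 < `|z|)%N -> g z = 0.
Hypothesis g_top : g k.+1%:Z = (-1) ^+ k.+1 * \prod_(i < k.+1) x i.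
Hypothesis g_root : forall i, (i <= k)%N ->
  \sum_(j < (2 * k.+1).+1) g (j%:Z - k.+1%:Z) * x i ^+ j = 0.

Lemma kernel_coef_top tau kap r s : (s < r)%N ->
  kernel_coef g tau kap (k.+1 + r) s = 0.
Proof. by move=> sr; rewrite /kernel_coef !g_supp ?mulr0 ?addr0 //; lia. Qed.

Lemma dual_determinant_odd :
  ndet k.+1 (fun j i =>
    if j == 0%N then x i ^+ (k + m) - x i ^+ (k + m).+1
    else x i ^+ (k - j) - x i ^+ (k.+1 + (2 * m) + j))
  = (-1) ^+ m * (\prod_(i < k.+1) (1 - x i)) * weyl k x
    * ndet m (fun s t => kernel_coef g (-1) 1 s.+1 t).
Proof.
pose A u i := x i ^+ (k.+1 + m - u.+1) - x i ^+ (k.+1 + m + u).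
have AE u i : (u <= k)%N -> (i <= k)%N ->
    A u i = (1 - x i) * x i ^+ (k + m) * (cheb 1 1 u).[(1 + x i ^+ 2) / x i].
  move=> uk ik; have xi := x_neq0 ik.
  pose H u := x i ^- u - x i ^+ u.+1.
  (* Both sides obey the recurrence in y = x + 1/x; gam = 1 because 1/x - x^2 = (1 - x)(y + 1). *)
  have HE : H u = (1 - x i) * (cheb 1 1 u).[(1 + x i ^+ 2) / x i].
    case: u {uk} => [|u]; first by rewrite /H hornerC expr0 invr1; ring.
    by apply: cheb_eval => [||v]; rewrite /H ?exprS; field; rewrite ?xi ?expf_neq0 ?oner_eq0.
  rewrite mulrAC -HE /H /A (_ : (k.+1 + m - u.+1)%N = (k + m - u)%N); last lia.
  rewrite (_ : (k.+1 + m + u)%N = (k + m + u.+1)%N); last lia.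
  have un : (u <= k + m)%N by lia.
  rewrite (exprB un) ?unitfE // [x i ^+ (_ + u.+1)]exprD; move: (k + m)%N => n.
  by field; rewrite expf_neq0.
have := dual_determinant (eta := fun=> 1) x_neq0 (fun u => (cheb_monic_size 1 1 u).1)
  (fun u => (cheb_monic_size 1 1 u).2) g_top AE.
move=> /(_ (kernel_coef g (-1) 1)); rewrite big1 // => <-.
- by rewrite mul1r; apply: eq_ndet => -[|j] i jk ik; rewrite /A /=; congr (_ ^+ _ - _ ^+ _); lia.
- move=> i s ik sm; apply: kernel_relation_odd => //; exact: g_root.
- by move=> r s /andP [sr _]; apply: kernel_coef_top.
- move=> s sm; rewrite /kernel_coef [g (_ + _ + _)]g_supp ?mulr0 ?addr0 ?mul1r; last lia.
  by congr (g _); lia.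
Qed.

Lemma dual_determinant_symplectic :
  ndet k.+1 (fun j i =>
    if j == 0%N then x i ^+ (k + m) - x i ^+ (k + m).+2
    else x i ^+ (k - j) - x i ^+ (k.+1 + (2 * m).+1 + j))
  = (-1) ^+ m * (\prod_(i < k.+1) (1 - x i ^+ 2)) * weyl k x
    * ndet m (fun s t => kernel_coef g (-1) 2 s.+1 t).
Proof.
pose A u i := x i ^+ (k.+1 + m - u.+1) - x i ^+ (k.+1 + m + u.+1).
have AE u i : (u <= k)%N -> (i <= k)%N ->
    A u i = (1 - x i ^+ 2) * x i ^+ (k + m) * (cheb 0 1 u).[(1 + x i ^+ 2) / x i].
  move=> uk ik; have xi := x_neq0 ik.
  pose H u := x i ^- u - x i ^+ u.+2.
  (* Here gam = 0, since 1/x - x^3 = (1 - x^2)(x + 1/x). *)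
  have HE : H u = (1 - x i ^+ 2) * (cheb 0 1 u).[(1 + x i ^+ 2) / x i].
    case: u {uk} => [|u]; first by rewrite /H hornerC expr0 invr1; ring.
    by apply: cheb_eval => [||v]; rewrite /H ?exprS; field; rewrite ?xi ?expf_neq0 ?oner_eq0.
  rewrite mulrAC -HE /H /A (_ : (k.+1 + m - u.+1)%N = (k + m - u)%N); last lia.
  rewrite (_ : (k.+1 + m + u.+1)%N = (k + m + u.+2)%N); last lia.
  have un : (u <= k + m)%N by lia.
  rewrite (exprB un) ?unitfE // [x i ^+ (_ + u.+2)]exprD; move: (k + m)%N => n.
  by field; rewrite expf_neq0.
have := dual_determinant (eta := fun=> 1) x_neq0 (fun u => (cheb_monic_size 0 1 u).1)
  (fun u => (cheb_monic_size 0 1 u).2) g_top AE.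
move=> /(_ (kernel_coef g (-1) 2)); rewrite big1 // => <-.
- by rewrite mul1r; apply: eq_ndet => -[|j] i jk ik; rewrite /A /=; congr (_ ^+ _ - _ ^+ _); lia.
- move=> i s ik sm; apply: kernel_relation_symplectic => //; exact: g_root.
- by move=> r s /andP [sr _]; apply: kernel_coef_top.
- move=> s sm; rewrite /kernel_coef [g (_ + _ + _)]g_supp ?mulr0 ?addr0 ?mul1r; last lia.
  by congr (g _); lia.
Qed.

Lemma dual_determinant_even : (0 < m)%N ->
  2 * ndet k.+1 (fun j i =>
    if j == 0%N then x i ^+ (k + m)
    else x i ^+ (k - j) + x i ^+ (k.+1 + (2 * m).-1 + j))
  = (-1) ^+ m * weyl k x * ndet m (fun s t => kernel_coef g 1 0 s.+1 t).
Proof.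
move=> m0.
pose A u i := if u == 0%N then x i ^+ (k.+1 + m - 1)
              else x i ^+ (k.+1 + m - u.+1) + x i ^+ (k.+1 + m - 1 + u).
have AE u i : (u <= k)%N -> (i <= k)%N ->
    A u i = 1 * x i ^+ (k + m) * (cheb 0 2 u).[(1 + x i ^+ 2) / x i].
  move=> uk ik; have xi := x_neq0 ik; rewrite /A mul1r.
  rewrite (_ : (k.+1 + m - 1)%N = (k + m)%N); last lia.
  case: u uk => [|u] uk /=; first by rewrite hornerC mulr1.
  pose H u := x i ^- u + x i ^+ u.
  (* The recurrence starts from H 0 = 2, twice the basis vector 1 of index 0; hence e = 2. *)
  have HE : H u.+1 = 1 * (cheb 0 2 u.+1).[(1 + x i ^+ 2) / x i].
    by apply: cheb_eval => [||v]; rewrite /H ?exprS; field; rewrite ?xi ?expf_neq0 ?oner_eq0.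
  rewrite -[X in _ * X]mul1r -HE /H (_ : (k.+1 + m - u.+2)%N = (k + m - u.+1)%N); last lia.
  have un : (u.+1 <= k + m)%N by lia.
  rewrite (exprB un) ?unitfE // [x i ^+ (_ + u.+1)]exprD; move: (k + m)%N => n.
  by field; rewrite expf_neq0.
have e2 : \prod_(s < m) (if s == 0%N :> nat then 2 else 1) = 2 :> F.
  by rewrite -(prednK m0) big_ord_recl /= big1 ?mulr1.
have := dual_determinant (eta := fun s => if s == 0%N then 2 else 1)
  x_neq0 (fun u => (cheb_monic_size 0 2 u).1)
  (fun u => (cheb_monic_size 0 2 u).2) g_top AE.
move=> /(_ (kernel_coef g 1 0)); rewrite e2 [\prod_(i < k.+1) 1]big1 // mulr1 => <-.
- congr (_ * _); apply: eq_ndet => -[|j] i jk ik; rewrite /A /=.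
    by congr (_ ^+ _); lia.
  by rewrite addn_eq0 andbF; congr (_ ^+ _ + _ ^+ _); lia.
- move=> i s ik sm; apply: kernel_relation_even => //; exact: g_root.
- by move=> r s /andP [sr _]; apply: kernel_coef_top.
(* For s = 0 and kap = 0 both terms of the coefficient equal g(k + 1), so this one diagonal entry is
   doubled: the source of the factor 2. *)
- move=> s sm; rewrite /kernel_coef; case: (posnP s) => [->|s0].
    by rewrite mul1r mulr_natl mulr2n; congr (g _ + g _); lia.
  rewrite [g (_ + _ + _)]g_supp ?mulr0 ?addr0 ?mul1r; last lia.
  by congr (g _); lia.
Qed.

End Cases.

(** * Elementary symmetric polynomials and Schur sums *)

Section ElementaryKernel.
Variable K : nat.
Notation R := {mpoly rat[K]}.
Notation e := (mesym K rat).

(** The product is expanded over the sets of indices j that contribute [c * 'X_j], grouped by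
    cardinality. *)
Lemma prod_linear_mesym (a c : R) :
  \prod_(j < K) (a + c * 'X_j) = \sum_(b < K.+1) c ^+ b * a ^+ (K - b) * e b.
Proof.
under eq_bigr => j _ do rewrite addrC.
rewrite bigA_distr /=.
rewrite (partition_big (fun J : {set 'I_K} => inord #|J| : 'I_K.+1) xpredT) //=.
have cJ (J : {set 'I_K}) : (#|J| < K.+1)%N.
  by rewrite ltnS -[X in (_ <= X)%N]card_ord max_card.
apply: eq_bigr => b _; rewrite /mesym mulr_sumr; apply: eq_big => [J|J].
  by rewrite -val_eqE /= inordK.
rewrite -val_eqE /= inordK // => /eqP <-.
rewrite (bigID (mem J)) /= (eq_bigr (fun j => c * 'X_j)) => [|j ->//].
rewrite [X in _ * X](eq_bigr (fun=> a)) => [|j /negbTE ->//].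
rewrite big_split /= !prodr_const mulrAC; congr (_ * _ * _).
congr (_ ^+ _); apply: (@addnI #|J|); rewrite subnKC; last by rewrite -ltnS.
exact: etrans (cardC _) (card_ord K).
Qed.

(* The coefficients of the Laurent polynomial
   prod_j (1 - x_j t) (1 - x_j / t). *)
Definition gker (z : int) : R := (-1) ^+ `|z|%N * f_poly K z.

Lemma gker_even z : gker (- z) = gker z.
Proof. by rewrite /gker /f_poly abszN. Qed.

Lemma f_poly_out z : (K < `|z|)%N -> f_poly K z = 0.
Proof.
move=> Kz; rewrite /f_poly (_ : (K.+1 - `|z|)%N = 0%N) ?big_ord0 //; lia.
Qed.

Lemma gker_supp z : (K < `|z|)%N -> gker z = 0.
Proof. by move=> Kz; rewrite /gker f_poly_out ?mulr0. Qed.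

Lemma gker_top : gker K%:Z = (-1) ^+ K * \prod_(i < K) 'X_i.
Proof.
rewrite /gker /f_poly absz_nat subSn // subnn big_ord1 addn0.
by rewrite mesym0E mul1r mesymnnE.
Qed.

Lemma f_poly_wide (i : nat) : f_poly K i = \sum_(b < K.+1) e b * e (i + b)%N.
Proof.
rewrite /f_poly absz_nat.
rewrite (big_ord_widen_cond K.+1 xpredT (fun b => e b * e (i + b)%N)) ?leq_subr //.
rewrite big_mkcond /=; apply: eq_bigr => b _; case: ltnP => // ib.
by rewrite (@mesym_geqnE _ _ (i + b)%N) ?mulr0 //; lia.
Qed.

(** The sum is the value at x_i of [P1 * P2], where [P1] has the coefficients of prod (1 - x_j t)
    and [P2] those of prod (t - x_j); the latter vanishes at x_i. *)
Lemma gker_root i : \sum_(j < (2 * K).+1) gker (j%:Z - K%:Z) * 'X_i ^+ j = 0.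
Proof.
pose P1 : {poly R} := \poly_(a < K.+1) ((-1) ^+ a * e a).
pose P2 : {poly R} := \poly_(a < K.+1) ((-1) ^+ (K - a) * e (K - a)%N).
have P20 : P2.['X_i] = 0.
  rewrite horner_poly (reindex_inj rev_ord_inj) /=.
  transitivity (\prod_(j < K) ('X_i + (-1) * 'X_j : R)).
    rewrite prod_linear_mesym; apply: eq_bigr => b _; rewrite subSS subKn -1?ltnS //.
    by rewrite mulrAC.
  by rewrite (bigD1 i) //= mulN1r subrr mul0r.
have : (P1 * P2).['X_i] = 0 by rewrite hornerM P20 mulr0.
rewrite (horner_coef_wide (n := (2 * K).+1)); last first.
  apply: leq_trans (size_polyMleq _ _) _.
  have s1 : (size P1 <= K.+1)%N by apply: size_poly.
  have s2 : (size P2 <= K.+1)%N by apply: size_poly.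
  by rewrite -subn1 leq_subLR; apply: leq_trans (leq_add s1 s2) _; lia.
move=> h; rewrite -[RHS]h; apply: eq_bigr => j _; congr (_ * _).
(* For j > K the first j - K terms of the convolution vanish, because [P2] has degree at most K. *)
rewrite coefM; case: (leqP j K) => jK.
  rewrite /gker (_ : `|j%:Z - K%:Z|%N = (K - j)%N); last lia.
  rewrite /f_poly (_ : `|j%:Z - K%:Z|%N = (K - j)%N); last lia.
  rewrite (_ : (K.+1 - (K - j))%N = j.+1); last lia.
  rewrite mulr_sumr; apply: eq_bigr => a _; rewrite !coef_poly.
  rewrite !ifT; [|have := ltn_ord a; lia ..].
  rewrite (_ : (K - (j - a))%N = (K - j + a)%N); last by have := ltn_ord a; lia.
  rewrite exprD mulrACA [X in _ = X * _]mulrCA -expr2 sqrr_sign mulr1 //.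
rewrite (_ : j%:Z - K%:Z = (j - K)%N%:Z); last lia.
rewrite /gker f_poly_wide absz_nat.
have -> : j.+1 = (j - K + K.+1)%N by lia.
rewrite [RHS]big_split_ord /= [X in _ = X + _]big1 ?add0r => [|a _]; last first.
  by rewrite [X in _ * X]coef_poly ifF ?mulr0 //; have := ltn_ord a; lia.
rewrite mulr_sumr; apply: eq_bigr => b _.
have := ltn_ord b; rewrite ltnS => bK.
rewrite !coef_poly (_ : (j - (j - K + b))%N = (K - b)%N); last lia.
have -> : (K - b < K.+1)%N by lia.
rewrite subKn //.
case: ltnP => jb; last by rewrite (@mesym_geqnE _ _ (j - K + b)%N) ?mulr0 ?mul0r //; lia.
rewrite exprD mulrACA [X in _ = X * _]mulrAC -mulrA -expr2 sqrr_sign mulr1.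
by rewrite [e _ * e b]mulrC.
Qed.

End ElementaryKernel.

Lemma schur_eq0 n l : (n < size l)%N -> schur n l = 0.
Proof. by move=> nl; rewrite /schur leqNgt nl. Qed.

Lemma frob_list_stats c d b l : (d <= c)%N -> l \in frob_list c d b ->
  (0 < rk l)%N /\
  rk (hook_add (b.+1 + c) b.+1 l) = (rk l).+1 /\
  sumn (hook_add (b.+1 + c) b.+1 l) = (sumn l + (b.+1 + c) + b.+1 + 1)%N.
Proof.
move=> dc lb; have [pl sl hl] := frob_list_bound dc lb.
rewrite rk_hook_add // sumn_hook_add //; split=> //.
have [_ [al [_ _ e _]]] := frob_list_shape dc lb.
have <- : size (frob_arm l) = rk l by rewrite size_map size_iota.
by rewrite e size_rcons.
Qed.

Lemma rk_seq1 d : rk [:: d.+1] = 1%N.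
Proof. by rewrite (rk_hook_add d (l := [::]) (b := 0)) // /rk big_geq. Qed.

(** All signs in an entry depend on s + 1 + t up to the constant (-1)^kap, so they factor over rows
    and columns; index s contributes (-1)^(2s+1) in total. *)
Lemma ndet_kernel_coef (S : comNzRingType) m (f : int -> S) (tau sg : S) kap :
  tau * (-1) ^+ kap = sg ->
  ndet m (fun s t => kernel_coef (fun z => (-1) ^+ `|z|%N * f z) tau kap s.+1 t)
  = (-1) ^+ m
    * ndet m (fun s t => f (s.+1%:Z - t%:Z) + sg * f (s.+1%:Z + t%:Z + kap%:Z)).
Proof.
move=> <-.
transitivity (ndet m (fun s t => (-1) ^+ s.+1 * (-1) ^+ t *
    (f (s.+1%:Z - t%:Z) + tau * (-1) ^+ kap * f (s.+1%:Z + t%:Z + kap%:Z)))).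
  apply: eq_ndet => s t sm tm; rewrite /kernel_coef.
  have -> : (-1) ^+ absz (s.+1%:Z - t%:Z) = (-1) ^+ s.+1 * (-1) ^+ t :> S.
    rewrite -exprD -signr_odd -[RHS]signr_odd; congr (_ ^+ nat_of_bool _); lia.
  have -> : absz (s.+1%:Z + t%:Z + kap%:Z) = (s.+1 + t + kap)%N by lia.
  by rewrite !exprD; ring.
rewrite (ndet_scale m (fun s => (-1) ^+ s.+1) (fun t => (-1) ^+ t)
  (fun s t => f (s.+1%:Z - t%:Z) + tau * (-1) ^+ kap * f (s.+1%:Z + t%:Z + kap%:Z))).
congr (_ * _); rewrite -big_split -[in RHS](card_ord m) -prodr_const /=.
apply: eq_bigr => i _; rewrite -exprD addSn addnn exprS -signr_odd odd_double.
by rewrite mulr1.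
Qed.

(** Without variables f_i = 0 for i != 0. In the last row s - t + 1 is positive, so that row is
    zero. *)
Lemma det_f_poly0 m (h : nat -> int) (sg : {mpoly rat[0]}) : (0 < m)%N ->
  (forall t, h t != 0) ->
  \det (\matrix_(s < m, t < m)
     (f_poly 0 (s.+1%:Z - t.+1%:Z + 1) + sg * f_poly 0 (h (s + t)%N))) = 0.
Proof.
move=> m0 h0; have lm : (m.-1 < m)%N by rewrite prednK.
rewrite (expand_det_row _ (Ordinal lm)) big1 // => t _; rewrite !mxE /=.
rewrite !f_poly_out ?mulr0 ?addr0 ?mul0r //; first by rewrite absz_gt0.
by have := ltn_ord t; lia.
Qed.

(** * Transfer to Schur polynomials in the field of fractions *)

Section SchurSums.
Variable k : nat.
Notation R := {mpoly rat[k.+1]}.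
Notation F := {fraction {mpoly rat[k.+1]}}.

Definition xvar (i : nat) : F := tofrac ('X_(inord i) : R).

Lemma xvar_ord (i : 'I_k.+1) : xvar i = tofrac ('X_i).
Proof. by rewrite /xvar inord_val. Qed.

Lemma xvar_neq0 i : xvar i != 0.
Proof.
by rewrite tofrac_eq0 -msize_poly_eq0 msizeX mdeg1.
Qed.

Lemma tofrac_alternant l : tofrac (alternant k.+1 l) = nalternant xvar k.+1 l.
Proof.
rewrite /nalternant -ndet_tr /alternant /ndet -det_map_mx; congr (\det _).
by apply/matrixP=> i j; rewrite !mxE rmorphXn xvar_ord.
Qed.

(** Taking x_i^k out of column i leaves powers of 1/x_i, to which [ndet_homogeneous] applies with
    a_i = 1 and b_i = x_i. *)
Lemma alternant_nilE : tofrac (alternant k.+1 [::])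
  = \prod_(i < k.+1) \prod_(j < k.+1 | (i < j)%N) (xvar i - xvar j).
Proof.
rewrite tofrac_alternant /nalternant.
transitivity (ndet k.+1 (fun u i => xvar i ^+ k.+1.-1 * ('X^u : {poly F}).[1 / xvar i])).
  apply: eq_ndet => u i uk _; rewrite /part nth_nil add0n subSS hornerXn expr_div_n expr1n.
  rewrite (exprB (n := u)) ?unitfE ?xvar_neq0 //.
  by rewrite mul1r.
rewrite (ndet_homogeneous (p := fun u => 'X^u) (fun=> 1)) => [|u|u|i _].
- by apply: eq_bigr => i _; apply: eq_bigr => j _; rewrite !mul1r.
- exact: monicXn.
- exact: size_polyXn.
- exact: xvar_neq0.
Qed.

Lemma alternant_nil_neq0 : tofrac (alternant k.+1 [::]) != 0.
Proof.
rewrite alternant_nilE; apply/prodf_neq0 => i _; apply/prodf_neq0 => j ij.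
rewrite !xvar_ord -tofracB tofrac_eq0 subr_eq0.
apply/eqP => /(congr1 (mcoeff U_(i))) /eqP; rewrite !mcoeffXU eqxx.
have -> : (j == i) = false by rewrite -val_eqE /= gtn_eqF.
by rewrite oner_eq0.
Qed.

Lemma weyl_xvar : weyl k xvar = tofrac (alternant k.+1 [::])
  * \prod_(i < k.+1) \prod_(j < k.+1 | (i < j)%N) (1 - xvar i * xvar j).
Proof.
rewrite alternant_nilE -big_split; apply: eq_bigr => i _ /=.
by rewrite -big_split; apply: eq_bigr => j _ /=; ring.
Qed.

Lemma sum_schur c d (sg : F) (w : seq nat -> F) :
  (d <= c)%N ->
  (forall b l, l \in frob_list c d b ->
     w (hook_add (b.+1 + c) b.+1 l) = (-1) ^+ b.+1 * sg * w l) ->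
  \sum_(l <- frob_list c d k) w l * schur k.+1 l
  = w [:: d.+1] * ndet k.+1 (fun j i =>
      if j == 0%N then xvar i ^+ (k.+1 + d)
      else xvar i ^+ (k - j) + sg * xvar i ^+ (k.+1 + c + j))
    / tofrac (alternant k.+1 [::]).
Proof.
move=> dc wS; rewrite -(sum_nalternant xvar k dc wS) mulr_suml.
apply: eq_big_seq => l /(frob_list_bound dc) [_ sl _].
by rewrite /schur sl tofrac_alternant mulrA.
Qed.

Definition kerF (z : int) : F := (-1) ^+ `|z|%N * tofrac (f_poly k.+1 z).

Lemma kerFE z : kerF z = tofrac (gker k.+1 z).
Proof. by rewrite /kerF /gker rmorphM rmorph_sign. Qed.

Lemma kerF_even z : kerF (- z) = kerF z.
Proof. by rewrite !kerFE gker_even. Qed.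

Lemma kerF_supp z : (k.+1 < `|z|)%N -> kerF z = 0.
Proof. by move=> kz; rewrite kerFE gker_supp ?rmorph0. Qed.

Lemma kerF_top : kerF k.+1%:Z = (-1) ^+ k.+1 * \prod_(i < k.+1) xvar i.
Proof.
rewrite kerFE gker_top rmorphM rmorph_sign rmorph_prod; congr (_ * _).
by apply: eq_bigr => i _; rewrite xvar_ord.
Qed.

Lemma kerF_root i : \sum_(j < (2 * k.+1).+1) kerF (j%:Z - k.+1%:Z) * xvar i ^+ j = 0.
Proof.
rewrite -[RHS](rmorph0 (@tofrac R)) -[in RHS](gker_root (inord i)) rmorph_sum.
by apply: eq_bigr => j _; rewrite rmorphM rmorphXn kerFE.
Qed.

Lemma tofrac_det m (h : nat -> nat -> R) :
  tofrac (\det (\matrix_(s < m, t < m) h s t)) = ndet m (fun s t => tofrac (h s t)).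
Proof. by rewrite -det_map_mx; congr (\det _); apply/matrixP=> s t; rewrite !mxE. Qed.

Lemma tofrac_half (P : R) : 2 * tofrac (2^-1 *: P) = tofrac P.
Proof.
rewrite mulr_natl -rmorphMn; congr tofrac.
by rewrite -scaler_nat scalerA mulfV ?scale1r.
Qed.

Lemma tofrac_prod :
  tofrac (\prod_(i < k.+1) (1 - 'X_i) : R) = \prod_(i < k.+1) (1 - xvar i).
Proof.
by rewrite rmorph_prod; apply: eq_bigr => i _; rewrite rmorphB rmorph1 xvar_ord.
Qed.

Lemma tofrac_prod_le :
  tofrac (\prod_(i < k.+1) \prod_(j < k.+1 | (i <= j)%N) (1 - 'X_i * 'X_j) : R)
  = \prod_(i < k.+1) (1 - xvar i ^+ 2)
    * \prod_(i < k.+1) \prod_(j < k.+1 | (i < j)%N) (1 - xvar i * xvar j).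
Proof.
rewrite rmorph_prod -big_split; apply: eq_bigr => i _ /=.
rewrite rmorph_prod (bigD1 i) //= rmorphB rmorph1 rmorphM -expr2 xvar_ord.
congr (_ * _); apply: eq_big => [j|j _].
  by rewrite ltn_neqAle andbC -val_eqE eq_sym.
by rewrite rmorphB rmorph1 rmorphM !xvar_ord.
Qed.

Lemma tofrac_prod_lt :
  tofrac (\prod_(i < k.+1) \prod_(j < k.+1 | (i < j)%N) (1 - 'X_i * 'X_j) : R)
  = \prod_(i < k.+1) \prod_(j < k.+1 | (i < j)%N) (1 - xvar i * xvar j).
Proof.
rewrite rmorph_prod; apply: eq_bigr => i _; rewrite rmorph_prod.
by apply: eq_bigr => j _; rewrite rmorphB rmorph1 rmorphM !xvar_ord.
Qed.

End SchurSums.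

Lemma schur0_eq0 l c d : frob_shape c d l -> schur 0 l = 0.
Proof.
move=> [_ [al [_ _ e _]]]; apply: schur_eq0; case: l e => // e.
by move: (congr1 size e); rewrite frob_nil size_rcons.
Qed.

(** * The three identities in at least one variable *)

Lemma identity_odd k m : (0 < m)%N ->
  \sum_(delta < 2) \sum_(l \in frob_shape (2 * m) (m - delta))
    (-1) ^+ ((sumn l + rk l - delta + m)./2 + m * rk l) * schur k.+1 l
  = tofrac
      (\prod_(i < k.+1) (1 - 'X_i)
       * \prod_(i < k.+1) \prod_(j < k.+1 | (i < j)%N) (1 - 'X_i * 'X_j)
       * \det (\matrix_(s < m, t < m)
                 (f_poly k.+1 (s.+1%:Z - t.+1%:Z + 1)
                  + f_poly k.+1 (s.+1%:Z + t.+1%:Z)))).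
Proof.
move=> m0.
pose w delta l : {fraction {mpoly rat[k.+1]}} :=
  (-1) ^+ ((sumn l + rk l - delta + m)./2 + m * rk l).
have term delta : (delta <= 1)%N ->
  \sum_(l \in frob_shape (2 * m) (m - delta)) w delta l * schur k.+1 l =
  (-1) ^+ (1 - delta) * ndet k.+1 (fun j i =>
      if j == 0%N then xvar k i ^+ (k.+1 + (m - delta))
      else xvar k i ^+ (k - j) + (-1) * xvar k i ^+ (k.+1 + 2 * m + j))
    / tofrac (alternant k.+1 [::]).
  move=> d1; have dm : (m - delta <= 2 * m)%N by lia.
  rewrite (@sum_frob_shape _ _ _ k) // => [|l kl]; last by rewrite schur_eq0 ?mulr0.
  rewrite (@sum_schur k _ _ (-1)) //.
    congr (_ * _ / _); rewrite /w rk_seq1 /= addn0 -signr_odd -[RHS]signr_odd.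
    by congr (_ ^+ nat_of_bool _); lia.
  (* The hook adds 2m + 2(b + 1) + 2 to the numerator and m to [m * rk l], so the sign changes by
     (-1)^(b+1) * (-1). Since 0 < [rk l], the truncated subtraction of [delta] is exact. *)
  move=> b l lb; rewrite /w; have [r0 [-> ->]] := frob_list_stats dm lb.
  rewrite -exprSr -exprD mulnS -signr_odd -[RHS]signr_odd.
  by congr (_ ^+ nat_of_bool _); move: (m * rk l)%N => z; lia.
have V0 := alternant_nil_neq0 k.
rewrite [LHS]big_ord_recl big_ord1 (term 0%N) // (term 1%N) //.
rewrite -mulrDl; apply: (mulIf V0); rewrite mulfVK //.
rewrite !tofracM tofrac_prod_lt tofrac_prod.
(* The determinants for delta = 0, 1 differ only in row 0, where they carry -x^(k+m+1) and x^(k+m);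
   linearity merges them. *)
transitivity (ndet k.+1 (fun j i =>
    if j == 0%N then xvar k i ^+ (k + m) - xvar k i ^+ (k + m).+1
    else xvar k i ^+ (k - j) - xvar k i ^+ (k.+1 + (2 * m) + j))); last first.
  rewrite (dual_determinant_odd _ (fun i _ => xvar_neq0 k i) (@kerF_even k) (@kerF_supp k)
    (kerF_top k) (fun i _ => kerF_root k i)) weyl_xvar.
  rewrite (@ndet_kernel_coef _ m (fun z => tofrac (f_poly k.+1 z)) (-1) 1 1) ?mulrNN ?mulr1 //.
  rewrite (@tofrac_det k m (fun s t => f_poly k.+1 (s.+1%:Z - t.+1%:Z + 1)
                                  + f_poly k.+1 (s.+1%:Z + t.+1%:Z))).
  set P1 := \prod_(i < k.+1) (1 - xvar k i); set V := tofrac _.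
  set P2 := \prod_(i < k.+1) \prod_(j < k.+1 | _) _.
  set D1 := ndet _ _; set D2 := ndet _ _.
  have -> : D2 = D1.
    apply: eq_ndet => s t sm tm; rewrite rmorphD mul1r; congr (tofrac (f_poly _ _) + tofrac (f_poly _ _)); lia.
  transitivity ((-1) ^+ m * (-1) ^+ m * (P1 * P2 * D1 * V)); first by ring.
  by rewrite -expr2 sqrr_sign mul1r.
transitivity (ndet k.+1 (fun j i =>
    if j == 0%N then xvar k i ^+ (k + m) + (-1) * xvar k i ^+ (k + m).+1
    else xvar k i ^+ (k - j) - xvar k i ^+ (k.+1 + (2 * m) + j))); last first.
  by apply: eq_ndet => j i _ _; rewrite mulN1r.
rewrite ndet_row_linear // subn0 subnn expr1 expr0 mul1r addrC; congr (_ + _ * _);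
  by apply: eq_ndet => -[|j] i _ _ /=; rewrite ?mulN1r //; congr (_ ^+ _); lia.
Qed.

Lemma identity_symplectic k m : (0 < m)%N ->
  \sum_(l \in (frob_shape (2 * m + 1) (m + 1) `|` frob_shape (2 * m + 1) (m - 1))%classic)
    (-1) ^+ ((sumn l + m)./2 + m * rk l) * schur k.+1 l
  = tofrac
      (\prod_(i < k.+1) \prod_(j < k.+1 | (i <= j)%N) (1 - 'X_i * 'X_j)
       * \det (\matrix_(s < m, t < m)
                 (f_poly k.+1 (s.+1%:Z - t.+1%:Z + 1)
                  - f_poly k.+1 (s.+1%:Z + t.+1%:Z + 1)))).
Proof.
move=> m0.
pose w l : {fraction {mpoly rat[k.+1]}} := (-1) ^+ ((sumn l + m)./2 + m * rk l).
have term d : (d == m + 1)%N || (d == m - 1)%N ->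
  \sum_(l <- frob_list (2 * m + 1) d k) w l * schur k.+1 l =
  (-1) ^+ (d == m + 1)%N * ndet k.+1 (fun j i =>
      if j == 0%N then xvar k i ^+ (k.+1 + d)
      else xvar k i ^+ (k - j) + (-1) * xvar k i ^+ (k.+1 + (2 * m + 1) + j))
    / tofrac (alternant k.+1 [::]).
  move=> dE; have dm : (d <= 2 * m + 1)%N by lia.
  rewrite (@sum_schur k _ _ (-1)) //.
    congr (_ * _ / _); rewrite /w rk_seq1 /= addn0 -signr_odd.
    by congr (_ ^+ nat_of_bool _); case: eqP dE; lia.
  move=> b l lb; rewrite /w; have [r0 [-> ->]] := frob_list_stats dm lb.
  rewrite -exprSr -exprD mulnS -signr_odd -[RHS]signr_odd.
  by congr (_ ^+ nat_of_bool _); move: (m * rk l)%N => z; lia.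
have V0 := alternant_nil_neq0 k.
rewrite (@sum_frob_shapeU _ _ _ _ k); try lia; last first.
  by move=> l kl; rewrite schur_eq0 ?mulr0.
rewrite !term ?eqxx ?orbT // (_ : (m - 1 == m + 1)%N = false); last lia.
rewrite -mulrDl; apply: (mulIf V0); rewrite mulfVK //.
rewrite !tofracM tofrac_prod_le.
(* Row 0 is -x^(k+m+2) for d = m + 1 and x^(k+m) for d = m - 1. *)
transitivity (ndet k.+1 (fun j i =>
    if j == 0%N then xvar k i ^+ (k + m) - xvar k i ^+ (k + m).+2
    else xvar k i ^+ (k - j) - xvar k i ^+ (k.+1 + (2 * m).+1 + j))); last first.
  rewrite (dual_determinant_symplectic _ (fun i _ => xvar_neq0 k i) (@kerF_even k)
    (@kerF_supp k) (kerF_top k) (fun i _ => kerF_root k i)) weyl_xvar.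
  rewrite (@ndet_kernel_coef _ m (fun z => tofrac (f_poly k.+1 z)) (-1) (-1) 2); last first.
    by rewrite sqrrN expr1n mulr1.
  rewrite (@tofrac_det k m (fun s t => f_poly k.+1 (s.+1%:Z - t.+1%:Z + 1)
                                  - f_poly k.+1 (s.+1%:Z + t.+1%:Z + 1))).
  set P1 := \prod_(i < k.+1) (1 - xvar k i ^+ 2); set V := tofrac _.
  set P2 := \prod_(i < k.+1) \prod_(j < k.+1 | _) _.
  set D1 := ndet _ _; set D2 := ndet _ _.
  have -> : D2 = D1.
    apply: eq_ndet => s t sm tm; rewrite rmorphB mulN1r.
    by congr (tofrac (f_poly _ _) - tofrac (f_poly _ _)); lia.
  transitivity ((-1) ^+ m * (-1) ^+ m * (P1 * P2 * D1 * V)); first by ring.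
  by rewrite -expr2 sqrr_sign mul1r.
transitivity (ndet k.+1 (fun j i =>
    if j == 0%N then xvar k i ^+ (k + m) + (-1) * xvar k i ^+ (k + m).+2
    else xvar k i ^+ (k - j) - xvar k i ^+ (k.+1 + (2 * m).+1 + j))); last first.
  by apply: eq_ndet => j i _ _; rewrite mulN1r.
rewrite ndet_row_linear // expr1 expr0 mul1r addrC; congr (_ + _ * _);
  by apply: eq_ndet => -[|j] i _ _ /=; rewrite ?mulN1r ?addn1 //; congr (_ ^+ _); lia.
Qed.

Lemma identity_even k m : (0 < m)%N ->
  \sum_(l \in frob_shape (2 * m - 1) (m - 1))
    (-1) ^+ ((sumn l + m)./2 + m * rk l) * schur k.+1 l
  = tofrac
      (2^-1 *: (\prod_(i < k.+1) \prod_(j < k.+1 | (i < j)%N) (1 - 'X_i * 'X_j)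
       * \det (\matrix_(s < m, t < m)
                 (f_poly k.+1 (s.+1%:Z - t.+1%:Z + 1)
                  + f_poly k.+1 (s.+1%:Z + t.+1%:Z - 1))))).
Proof.
move=> m0.
pose w l : {fraction {mpoly rat[k.+1]}} := (-1) ^+ ((sumn l + m)./2 + m * rk l).
have V0 := alternant_nil_neq0 k.
have dm : (m - 1 <= 2 * m - 1)%N by lia.
rewrite (@sum_frob_shape _ _ _ k) // => [|l kl]; last by rewrite schur_eq0 ?mulr0.
rewrite (@sum_schur k _ _ 1 w) //; last first.
  move=> b l lb; rewrite /w; have [r0 [-> ->]] := frob_list_stats dm lb.
  rewrite mulr1 -exprD mulnS -signr_odd -[RHS]signr_odd.
  by congr (_ ^+ nat_of_bool _); move: (m * rk l)%N => z; lia.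
have -> : w [:: (m - 1).+1] = 1.
  rewrite /w rk_seq1 /= addn0 -signr_odd (_ : odd _ = false) //; lia.
apply: (mulIf V0); rewrite mulfVK // mul1r.
have two0 : 2 != 0 :> {fraction {mpoly rat[k.+1]}}.
  rewrite -(rmorph_nat (@tofrac _)) tofrac_eq0 -mpolyC_nat mpolyC_eq0; by [].
(* Doubling both sides removes the factor 1/2 and produces the left side of
   [dual_determinant_even]. *)
apply: (mulfI two0).
transitivity (2 * ndet k.+1 (fun j i =>
    if j == 0%N then xvar k i ^+ (k + m)
    else xvar k i ^+ (k - j) + xvar k i ^+ (k.+1 + (2 * m).-1 + j))).
  congr (_ * _); apply: eq_ndet => -[|j] i _ _ /=.
    by congr (_ ^+ _); lia.
  by rewrite mul1r subn1.
rewrite (dual_determinant_even (fun i _ => xvar_neq0 k i) (@kerF_even k)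
    (@kerF_supp k) (kerF_top k) (fun i _ => kerF_root k i)) // weyl_xvar.
rewrite (@ndet_kernel_coef _ m (fun z => tofrac (f_poly k.+1 z)) 1 1 0) ?mulr1 //.
rewrite [RHS]mulrA tofrac_half tofracM tofrac_prod_lt.
rewrite (@tofrac_det k m (fun s t => f_poly k.+1 (s.+1%:Z - t.+1%:Z + 1)
                                + f_poly k.+1 (s.+1%:Z + t.+1%:Z - 1))).
set V := tofrac _; set P2 := \prod_(i < k.+1) \prod_(j < k.+1 | _) _.
set D1 := ndet _ _; set D2 := ndet _ _.
have -> : D2 = D1.
  apply: eq_ndet => s t sm tm; rewrite rmorphD mul1r.
  by congr (tofrac (f_poly _ _) + tofrac (f_poly _ _)); lia.
transitivity ((-1) ^+ m * (-1) ^+ m * (P2 * D1 * V)); first by ring.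
by rewrite -expr2 sqrr_sign mul1r.
Qed.

(* The row and column indices s, t : 'I_m start at 0, so s.+1 and t.+1 are the
   indices 1 <= s, t <= m. *)
Theorem theorem5p2 (k m : nat) (m_gt0 : (0 < m)%N) :
  [/\ \sum_(delta < 2) \sum_(l \in frob_shape (2 * m) (m - delta))
        (-1) ^+ ((sumn l + rk l - delta + m)./2 + m * rk l) * schur k l
      = tofrac
          (\prod_(i < k) (1 - 'X_i)
           * \prod_(i < k) \prod_(j < k | (i < j)%N) (1 - 'X_i * 'X_j)
           * \det (\matrix_(s < m, t < m)
                     (f_poly k (s.+1%:Z - t.+1%:Z + 1)
                      + f_poly k (s.+1%:Z + t.+1%:Z)))),
      \sum_(l \in (frob_shape (2 * m + 1) (m + 1)
                   `|` frob_shape (2 * m + 1) (m - 1))%classic)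
        (-1) ^+ ((sumn l + m)./2 + m * rk l) * schur k l
      = tofrac
          (\prod_(i < k) \prod_(j < k | (i <= j)%N) (1 - 'X_i * 'X_j)
           * \det (\matrix_(s < m, t < m)
                     (f_poly k (s.+1%:Z - t.+1%:Z + 1)
                      - f_poly k (s.+1%:Z + t.+1%:Z + 1))))
    & \sum_(l \in frob_shape (2 * m - 1) (m - 1))
        (-1) ^+ ((sumn l + m)./2 + m * rk l) * schur k l
      = tofrac
          (2^-1 *: (\prod_(i < k) \prod_(j < k | (i < j)%N) (1 - 'X_i * 'X_j)
           * \det (\matrix_(s < m, t < m)
                     (f_poly k (s.+1%:Z - t.+1%:Z + 1)
                      + f_poly k (s.+1%:Z + t.+1%:Z - 1)))))].

Proof.
(* For k = 0 both sides vanish: every partition of these shapes is nonempty, and each determinant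
   has a zero row. *)
case: k => [|k]; last first.
  by split; [exact: identity_odd|exact: identity_symplectic|exact: identity_even].
have e1 : \det (\matrix_(s < m, t < m) (f_poly 0 (s.+1%:Z - t.+1%:Z + 1)
     + f_poly 0 (s.+1%:Z + t.+1%:Z))) = 0.
  rewrite -[RHS](@det_f_poly0 m (fun n => n.+2%:Z) 1 m_gt0) //.
  congr (\det _); apply/matrixP=> s t; rewrite !mxE mul1r.
  by congr (_ + f_poly _ _); lia.
have e2 : \det (\matrix_(s < m, t < m) (f_poly 0 (s.+1%:Z - t.+1%:Z + 1)
     - f_poly 0 (s.+1%:Z + t.+1%:Z + 1))) = 0.
  rewrite -[RHS](@det_f_poly0 m (fun n => n.+3%:Z) (-1) m_gt0) //.
  congr (\det _); apply/matrixP=> s t; rewrite !mxE mulN1r.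
  by congr (_ - f_poly _ _); lia.
have e3 : \det (\matrix_(s < m, t < m) (f_poly 0 (s.+1%:Z - t.+1%:Z + 1)
     + f_poly 0 (s.+1%:Z + t.+1%:Z - 1))) = 0.
  rewrite -[RHS](@det_f_poly0 m (fun n => n.+1%:Z) 1 m_gt0) //.
  congr (\det _); apply/matrixP=> s t; rewrite !mxE mul1r.
  by congr (_ + f_poly _ _); lia.
rewrite e1 e2 e3 !mulr0 scaler0 rmorph0; split.
- apply: big1 => d _; apply: fsbig1 => l /schur0_eq0 ->; exact: mulr0.
- apply: fsbig1 => l [] /schur0_eq0 ->; exact: mulr0.
- apply: fsbig1 => l /schur0_eq0 ->; exact: mulr0.
Qed.
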